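(* Let $\beta\in\mathbb{C}$ satisfy $\beta^2+2=0$, and put $$\varphi_4(x)=\frac{4\,x\,(x-1)\,(8\beta x+7-4\beta)^8}{(2048\beta x^3-3072\beta x^2-3264x^2+912\beta x+3264x+56\beta-17)^3}.$$ Then $\varphi_4:\mathbb{P}^1\to\mathbb{P}^1$ is a covering of degree $10$ which defines a pull-back transformation from a hypergeometric equation with local exponent differences $(1/2,1/3,1/8)$ (in some order at the singular points) to a hypergeometric equation with local exponent differences $(1/3,1/8,1/8)$ (in some order). Moreover, in a neighborhood of $x=0$ the following identities hold: $${}_2F_1\!\left(\tfrac{5}{24},\tfrac{13}{24};\tfrac78;x\right)=\left(1+\tfrac{16(4-17\beta)}{9}x-\tfrac{64(167-136\beta)}{243}x^2+\tfrac{2048(112-17\beta)}{6561}x^3\right)^{-1/16}{}_2F_1\!\left(\tfrac1{48},\tfrac{17}{48};\tfrac78;\varphi_4(x)\right),$$ $${}_2F_1\!\left(\tfrac{5}{24},\tfrac13;\tfrac23;x\right)=(1-x)^{-1/48}\left(1-\tfrac{8+7\beta}{16}x\right)^{-1/6}{}_2F_1\!\left(\tfrac1{48},\tfrac{7}{48};\tfrac23;\tfrac{1}{\varphi_4(1/x)}\right).$$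
   Context: ${}_2F_1(A,B;C;z)$ is the Gauss hypergeometric function, a solution of the hypergeometric equation $z(1-z)y''+(C-(A+B+1)z)y'-AB\,y=0$, whose local exponent differences at $z=0,1,\infty$ are (up to sign) $1-C$, $C-A-B$, $A-B$. A pull-back transformation is $z\mapsto\varphi(x)$, $y(z)\mapsto Y(x)=\theta(x)y(\varphi(x))$ with $\varphi$ a rational function and $\theta$ a product of powers of rational functions; it is said to be defined by the covering $\varphi$ (with suitable $\theta$), and it transforms the equation for $y$ into the equation for $Y$. The identities are between analytic functions near $x=0$; fractional powers of functions with value $1$ at $x=0$ denote the branch with value $1$ at $x=0$. *)

(* Defs.v *)
From HB Require Import structures.
From mathcomp Require Import all_boot all_order all_algebra.
From mathcomp Require Import complex.
From mathcomp Require Import boolp classical_sets functions reals topology.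
From mathcomp Require Import normedtype sequences derive.

Set Implicit Arguments.
Unset Strict Implicit.
Unset Printing Implicit Defensive.

Import Order.TTheory GRing.Theory Num.Theory numFieldNormedType.Exports.

Local Open Scope classical_set_scope.
Local Open Scope ring_scope.

(* R[i], packed as a numClosedFieldType: the type [cplx R] then carries the
   topology and the normed-module structure that numFieldNormedType gives to
   any numClosedFieldType; [derivable f x 1] and [derive1 f] are the complex
   derivative. *)
Definition cplx (R : realType) : numClosedFieldType := R[i].

(* A rational function, as a numerator and a denominator. *)
Record ratfun (K : fieldType) := RatFun { num : {poly K}; den : {poly K} }.

Definition rat_eval (K : fieldType) (f : ratfun K) (x : K) : K :=
  (num f).[x] / (den f).[x].

(* The projective line K + {oo}, with None as the point oo. *)
Definition P1 (K : fieldType) := option K.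

(* The point (a : b) of P1 in homogeneous coordinates. *)
Definition P1_point (K : fieldType) (a b : K) : P1 K :=
  if b == 0 then None else Some (a / b).

Definition rat_deg (K : fieldType) (f : ratfun K) : nat :=
  (maxn (size (num f)) (size (den f))).-1.

(* The map P1 -> P1 of a rational function given in lowest terms; at oo one
   takes the coefficients of degree [rat_deg f] of both polynomials. *)
Definition rat_map (K : fieldType) (f : ratfun K) (P : P1 K) : P1 K :=
  match P with
  | Some x => P1_point (num f).[x] (den f).[x]
  | None => P1_point (num f)`_(rat_deg f) (den f)`_(rat_deg f)
  end.

(* A polynomial whose zeros are the finite points of the fibre above Q. *)
Definition fibre_poly (K : fieldType) (f : ratfun K) (Q : P1 K) : {poly K} :=
  match Q with
  | Some c => num f - c *: den f
  | None => den f
  end.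

(* The multiplicity of P in its fibre. Near P = oo, in the coordinate t = 1/x,
   the fibre is cut out by t^(rat_deg f) h(1/t), with h the fibre polynomial,
   which vanishes at t = 0 to the order (rat_deg f - deg h). *)
Definition ram_index (K : fieldType) (f : ratfun K) (P : P1 K) : nat :=
  let h := fibre_poly f (rat_map f P) in
  match P with
  | Some x => mup x h
  | None => (rat_deg f - (size h).-1)%N
  end.

(* f is a (branched) covering P1 -> P1 of degree d: every fibre consists of d
   points, counted with multiplicity. *)
Definition is_covering (K : fieldType) (f : ratfun K) (d : nat) : Prop :=
  [/\ coprimep (num f) (den f), (0 < d)%N
    & forall Q : P1 K, exists s : seq (P1 K),
        [/\ uniq s, (forall P, (P \in s) = (rat_map f P == Q))
          & (\sum_(P <- s) ram_index f P)%N = d]].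

Section Hypergeometric.
Variable R : realType.
Local Notation C := (cplx R).

Definition pochhammer (a : C) (n : nat) : C := \prod_(k < n) (a + k%:R).

Definition hyp2F1 (a b c z : C) : C :=
  limn (series (fun n : nat =>
    pochhammer a n * pochhammer b n / (pochhammer c n * n`!%:R) * z ^+ n)).

Definition twice_derivable (y : C -> C) (z : C) : Prop :=
  derivable y z 1 /\ derivable (derive1 y) z 1.

Definition hypergeom_eq (a b c : C) (y : C -> C) (z : C) : Prop :=
  twice_derivable y z /\
  z * (1 - z) * derive1n 2 y z + (c - (a + b + 1) * z) * derive1 y z
    - a * b * y z = 0.

Definition eq_up_to_sign (u v : C) : Prop := u = v \/ u = - v.

(* The local exponents of the hypergeometric equation are 0, 1 - c at z = 0,
   0, c - a - b at z = 1, and a, b at z = oo. Their differences are those of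
   the list e, in some order and up to sign. *)
Definition exponent_differences (a b c : C) (e : seq C) : Prop :=
  exists e0 e1 eoo : C,
    [/\ perm_eq [:: e0; e1; eoo] e, eq_up_to_sign (1 - c) e0,
        eq_up_to_sign (c - a - b) e1 & eq_up_to_sign (a - b) eoo].

(* g is a continuous branch of f ^ r on the open set U (for an integer r, this
   is f ^ r itself). *)
Definition power_branch (U : set C) (f : C -> C) (r : rat) (g : C -> C) : Prop :=
  forall x, U x ->
    [/\ f x != 0, {for x, continuous g} & g x ^ denq r = f x ^ numq r].

(* The branch of f ^ r near x = 0 with value 1 at x = 0; as a germ it is
   unique. *)
Definition pow_at0 (f : C -> C) (r : rat) : C -> C :=
  get [set g | g 0 = 1 /\
    exists2 U : set C, open_nbhs 0 U & power_branch U f r g].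

(* A formal product of rational powers of nonzero rational functions, and its
   branches on U. *)
Definition radical := seq (ratfun C * rat).

Definition radical_nonzero (theta : radical) : bool :=
  all (fun p => (num p.1 != 0) && (den p.1 != 0)) theta.

Fixpoint radical_branch (U : set C) (theta : radical) (t : C -> C) : Prop :=
  match theta with
  | [::] => forall x, U x -> t x = 1
  | p :: theta' => exists g t' : C -> C,
      [/\ power_branch U (rat_eval p.1) p.2 g, radical_branch U theta' t'
        & forall x, U x -> t x = g x * t' x]
  end.

(* The points x which, with f x, avoid the singular points 0, 1, oo. *)
Definition regular_points (f : ratfun C) : set C :=
  [set x | [/\ x != 0, x != 1, (den f).[x] != 0, rat_eval f x != 0
             & rat_eval f x != 1]].

(* y(z) |-> theta(x) y(f(x)) transforms the hypergeometric equation of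
   parameters (a, b, c) into the one of parameters (a', b', c'): locally, away
   from the singular points and for every branch of theta, y satisfies the
   former if and only if theta (y o f) satisfies the latter. *)
Definition pullback_transforms (f : ratfun C) (theta : radical)
    (a b c a' b' c' : C) : Prop :=
  forall (U : set C) (t y : C -> C),
    open U -> U `<=` regular_points f -> radical_branch U theta t ->
    (forall x, U x -> twice_derivable y (rat_eval f x)) ->
    (forall x, U x -> hypergeom_eq a b c y (rat_eval f x)) <->
    (forall x, U x ->
      hypergeom_eq a' b' c' (fun x => t x * y (rat_eval f x)) x).

(* The covering f defines, with a suitable theta, a pull-back transformation
   from a hypergeometric equation with local exponent differences e to one with
   local exponent differences e'. *)
Definition defines_pullback (f : ratfun C) (e e' : seq C) : Prop :=
  exists (a b c a' b' c' : C) (theta : radical),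
    [/\ exponent_differences a b c e, exponent_differences a' b' c' e',
        radical_nonzero theta & pullback_transforms f theta a b c a' b' c'].

Definition phi4_num (beta : C) : {poly C} :=
  4 *: 'X * ('X - 1) * ((8 * beta) *: 'X + (7 - 4 * beta)%:P) ^+ 8.

Definition phi4_den (beta : C) : {poly C} :=
  ((2048 * beta) *: 'X^3 - (3072 * beta) *: 'X^2 - 3264 *: 'X^2
   + (912 * beta) *: 'X + 3264 *: 'X + (56 * beta - 17)%:P) ^+ 3.

Definition phi4 (beta : C) : ratfun C := RatFun (phi4_num beta) (phi4_den beta).

End Hypergeometric.

(* Main.v *)
Require Import Defs.
From HB Require Import structures.
From mathcomp Require Import all_boot all_order all_algebra.
From mathcomp Require Import complex.
From mathcomp Require Import boolp classical_sets functions reals topology.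
From mathcomp Require Import normedtype sequences derive.
From mathcomp Require Import ring zify.

Set Implicit Arguments.
Unset Strict Implicit.
Unset Printing Implicit Defensive.

Import Order.TTheory GRing.Theory Num.Theory numFieldNormedType.Exports.

Local Open Scope classical_set_scope.
Local Open Scope ring_scope.

(** Put w = (8 beta x + 7 - 4 beta) / 9. In this coordinate
    phi_4 = w^8 E / (4 Q^3) and phi_4 - 1 = 9 S^2 / (4 Q^3), with
    E = 9 w^2 - 14 w + 9, Q = 4 w^3 - 15 w^2 + 18 w - 9 and S of degree 5, all
    with rational coefficients; moreover E is a multiple of x (1 - x) and
    d phi_4 / dw = 9 w^7 S / Q^4. Hence theta = Q^(-1/16) transforms the one
    hypergeometric operator into the other one, up to the factor
    kappa = x (1 - x) phi_4'^2 / (phi_4 (1 - phi_4)) = 16 w^6 / Q^2. The same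
    computation at x = oo uses the coordinate v = 1 / w(1 / x).

    For the identities, both sides are solutions, regular at 0 and of value 1
    there, of the same hypergeometric equation. Their Wronskian W satisfies
    x W' = - q(x) W with q(0) = c > 0 and W(0) = 0, so |W|^2 does not increase
    along the rays from 0 and W vanishes; the quotient of the two solutions
    is then constant. *)

(** All ramification of [phi4] lies above 0, 1 and oo: order 8 at w = 0, order 2 at the zeros of S,
    order 3 at those of Q (7 + 5 + 6 = 18 = 2 * 10 - 2). There the exponent differences 1/8, 1/2,
    1/3 are multiplied to 1, and only x = 0, 1, oo, which are unramified, stay singular, with
    differences 1/8, 1/8, 1/3. The factor theta moves the local exponents at the poles back to 0 and
    1, and this fixes its powers.

    The obstacle is the right-hand sides of the identities: theta is only a continuous branch
    obtained by choice, so no power series is at hand and coefficients cannot be compared. What is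
    known of theta is its value at 0 and its logarithmic derivative. Hence the pull-back is computed
    from logarithmic derivatives, which are rational functions, and uniqueness is proved for
    solutions that are merely twice differentiable near 0. *)

Arguments cplx : simpl never.

(** * Derivatives through Caratheodory's criterion *)

Section Caratheodory.
Variable K : numFieldType.
Implicit Types (f g : K -> K) (x a b : K).

(** A difference quotient becomes a continuous factor defined also at x, so that compositions, roots
    and restrictions to rays reduce to algebra on such factors. *)
Lemma is_derive_caratheodory f x a :
  is_derive x 1 f a <->
  exists g, [/\ forall z, f z - f x = g z * (z - x),
                {for x, continuous g} & g x = a].
Proof.
split=> [[df <-]|[g [gE gc <-]]].
  exists (fun z => if z == x then 'D_1 f x else (f z - f x) / (z - x)).
  split=> [z||]; last by rewrite eqxx.
    by case: eqVneq => [->|zx]; rewrite ?subrr ?mulr0// divfK// subr_eq0.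
  apply/continuous_withinNshiftx; rewrite eqxx.
  apply: cvg_trans df; apply: near_eq_cvg.
  near=> h; rewrite /= ifN /=.
    by rewrite addrK mulrC [h%:A]mulr1.
  rewrite -subr_eq0 addrK; near: h; exact: nbhs_dnbhs_neq.
have dg : h^-1 *: (f (h *: 1 + x) - f x) @[h --> 0^'] --> g x.
  have := (continuous_withinNshiftx g x).2 gc.
  apply: cvg_trans; apply: near_eq_cvg; near=> h => /=.
  have h0 : h != 0 by near: h; exact: nbhs_dnbhs_neq.
  by rewrite gE [h%:A]mulr1 addrK /GRing.scale /= mulrCA mulVf ?mulr1 // addrC.
by split; [exact: cvgP dg|exact: cvg_lim dg].
Unshelve. all: by end_near. Qed.

Lemma is_derive_chain f g x a b :
  is_derive (g x) 1 f a -> is_derive x 1 g b ->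
  is_derive x 1 (fun z => f (g z)) (a * b).
Proof.
move=> /is_derive_caratheodory[f1 [f1E f1c <-]].
move=> /is_derive_caratheodory[g1 [g1E g1c <-]].
have gc : {for x, continuous g}.
  have -> : g = (fun z => g x + g1 z * (z - x)).
    by apply/funext => z; rewrite -g1E addrC subrK.
  apply: continuousD; first exact: cst_continuous.
  by apply: continuousM => //; apply: continuousB => //; exact: cst_continuous.
apply/is_derive_caratheodory; exists (fun z => f1 (g z) * g1 z); split=> //.
  by move=> z; rewrite f1E g1E mulrA.
by apply: continuousM => //; apply: (@continuous_comp _ _ _ g f1).
Qed.

Lemma is_derive_continuous f x a : is_derive x 1 f a -> {for x, continuous f}.
Proof. by case=> df _; apply/differentiable_continuous/derivable1_diffP. Qed.

Lemma is_derive_inv f x a : f x != 0 -> is_derive x 1 f a ->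
  is_derive x 1 (fun z => (f z)^-1) (- a / f x ^+ 2).
Proof.
move=> fx0 [df <-]; split; first exact: derivableV.
by rewrite deriveV // mulNr mulrC -mulNr.
Qed.

Lemma is_derive_mul f g x a b : is_derive x 1 f a -> is_derive x 1 g b ->
  is_derive x 1 (fun z => f z * g z) (a * g x + f x * b).
Proof. by move=> df dg; apply: is_derive_eq; rewrite addrC [g x *: _]mulrC. Qed.

Lemma is_derive_add f g x a b : is_derive x 1 f a -> is_derive x 1 g b ->
  is_derive x 1 (fun z => f z + g z) (a + b).
Proof. by move=> df dg; apply: is_deriveD. Qed.

Lemma is_derive_exp n f x a : is_derive x 1 f a ->
  is_derive x 1 (fun z => f z ^+ n) (n%:R * f x ^+ n.-1 * a).
Proof.
have -> : (fun z => f z ^+ n) = f ^+ n by apply/funext => z; rewrite exprfctE.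
by move=> df; apply: is_derive_eq.
Qed.

Lemma is_derive_sub f g x a b : is_derive x 1 f a -> is_derive x 1 g b ->
  is_derive x 1 (fun z => f z - g z) (a - b).
Proof. by move=> df dg; apply: is_deriveB. Qed.

Lemma is_derive_const b x : is_derive x 1 (fun=> b) 0.
Proof. exact: is_derive_cst. Qed.

Lemma is_derive_div f g x a b : g x != 0 ->
  is_derive x 1 f a -> is_derive x 1 g b ->
  is_derive x 1 (fun z => f z / g z) ((a * g x - f x * b) / g x ^+ 2).
Proof.
move=> gx0 df dg.
have := is_derive_mul df (is_derive_inv gx0 dg).
by move=> h; apply: is_derive_eq; field.
Qed.

Lemma is_derive_horner (p : {poly K}) x :
  is_derive x 1 (fun z => p.[z]) p^`().[x].
Proof.
elim/poly_ind: p => [|p c ih].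
  rewrite derivC horner0.
  have -> : (fun z => (0 : {poly K}).[z]) = fun=> 0 by apply/funext => z; rewrite horner0.
  exact: is_derive_const.
have -> : (fun z => (p * 'X + c%:P).[z]) = fun z => p.[z] * z + c.
  by apply/funext => z; rewrite hornerMXaddC.
have := is_derive_add (is_derive_mul ih (is_derive_id x 1)) (is_derive_const c x).
by move=> h; apply: is_derive_eq; rewrite derivMXaddC !hornerE; ring.
Qed.

Lemma near_is_derive_caratheodory f g x : {for x, continuous g} ->
  (\forall z \near x, f z - f x = g z * (z - x)) -> is_derive x 1 f (g x).
Proof.
move=> gc fE; apply: (@near_eq_is_derive _ _ _ (fun z => f x + g z * (z - x))).
  by near do (rewrite -(near fE _) 1?addrC ?subrK //).
apply/is_derive_caratheodory; exists g; split=> // z.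
by rewrite subrr mulr0 addr0 addrAC subrr add0r.
Unshelve. all: by end_near. Qed.

(* Dividing [g z ^+ n - g x ^+ n] by [g z - g x] leaves a sum that tends to
   [n g(x)^(n-1) != 0]. *)
Lemma is_derive_root n f g x a : (0 < n)%N -> g x != 0 ->
  {for x, continuous g} -> (\forall z \near x, g z ^+ n = f z) ->
  is_derive x 1 f a -> is_derive x 1 g (a / (n%:R * g x ^+ n.-1)).
Proof.
move=> n0 gx0 gc gnE /is_derive_caratheodory[f1 [f1E f1c <-]].
pose T z := \sum_(i < n) g z ^+ (n.-1 - i) * g x ^+ i.
have Tx : T x = n%:R * g x ^+ n.-1.
  rewrite /T (eq_bigr (fun=> g x ^+ n.-1)) ?sumr_const ?card_ord ?mulr_natl//.
  by move=> i _; rewrite -exprD subnK// -ltnS prednK.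
have Tx0 : T x != 0 by rewrite Tx mulf_neq0 ?pnatr_eq0 -?lt0n ?expf_neq0.
have Tc : {for x, continuous T}.
  pose p : {poly K} := \sum_(i < n) 'X^(n.-1 - i) * (g x ^+ i)%:P.
  have -> : T = (fun z => p.[g z]).
    by apply/funext => z; rewrite horner_sum; apply: eq_bigr => i _; rewrite !hornerE.
  by apply: continuous_comp gc (is_derive_continuous (is_derive_horner p (g x))).
rewrite -Tx; apply: near_is_derive_caratheodory (fun z => f1 z / T z) _ _ _.
  by apply: continuousM => //; exact: continuousV.
have Tn0 : \forall z \near x, T z != 0.
  exact: (cvgr_neq0 _ Tc Tx0).
near=> z.
have Tz0 : T z != 0 by near: z.
apply: (mulIf Tz0); rewrite mulrAC divfK // -f1E -(nbhs_singleton gnE).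
have <- : g z ^+ n = f z by near: z.
by rewrite subrXX.
Unshelve. all: by end_near. Qed.

(** The derivative is kept as a logarithmic derivative times the function, the form in which theta
    enters the pulled-back operator. *)
Lemma is_derive_exprz (p : int) f x a : f x != 0 ->
  is_derive x 1 f a ->
  is_derive x 1 (fun z => f z ^ p) (p%:~R * (a / f x) * f x ^ p).
Proof.
move=> fx0 df; case: p => n /=.
  apply: is_derive_eq (is_derive_exp n df) _.
  case: n => [|n]; first by rewrite !mul0r.
  by rewrite /= -exprnP -pmulrn exprS -!mulrA mulKf // [_ * a]mulrC.
apply: is_derive_eq (is_derive_inv _ (is_derive_exp n.+1 df)) _.
  exact: expf_neq0.
rewrite NegzE -exprnN /= (exprS (f x) n) mulrNz.
have fn0 : f x ^+ n != 0 by exact: expf_neq0.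
by rewrite -pmulrn; field; rewrite fx0 fn0.
Qed.

Lemma is_derive_exprz_root (n : nat) (p : int) f g x a : f x != 0 ->
  {for x, continuous g} -> (\forall z \near x, g z ^+ n.+1 = f z ^ p) ->
  is_derive x 1 f a ->
  g x != 0 /\ is_derive x 1 g (p%:~R / n.+1%:R * (a / f x) * g x).
Proof.
move=> fx0 gc gE df; have gxE := nbhs_singleton gE.
have gx0 : g x != 0.
  apply: contra_eq_neq gxE => ->; rewrite exprS mul0r.
  by rewrite eq_sym expfz_neq0.
split=> //.
apply: is_derive_eq (is_derive_root _ gx0 gc gE (is_derive_exprz p fx0 df)) _ => //.
rewrite -gxE exprS /=.
have gn0 : g x ^+ n != 0 by exact: expf_neq0.
have nR0 : n.+1%:R != 0 :> K by rewrite pnatr_eq0.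
set q : K := p%:~R.
by field; rewrite fx0 nat1r nR0 gn0.
Qed.

End Caratheodory.

(** * The pull-back of a hypergeometric operator *)

Section Pullback.
Variable C : numFieldType.

(** The left-hand side of [hypergeom_eq], over any [numFieldType]: the algebra and the series below
    do not refer to real and imaginary parts. *)
Definition hyp_op (a b c : C) (y : C -> C) (z : C) : C :=
  z * (1 - z) * derive1n 2 y z + (c - (a + b + 1) * z) * derive1 y z
    - a * b * y z.

Lemma derive1_val (f : C -> C) (x a : C) : is_derive x 1 f a -> derive1 f x = a.
Proof. by move=> df; rewrite derive1E derive_val. Qed.

Lemma derivable_derive1 (f : C -> C) (x : C) :
  derivable f x 1 -> is_derive x 1 f (derive1 f x).
Proof. by move=> df; rewrite derive1E; exact: derivableP. Qed.

Variables (t phi y L P : C -> C) (x L1 P1 : C).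
Hypothesis dt : \forall z \near x, is_derive (z : C) 1 t (L z * t z).
Hypothesis dphi : \forall z \near x, is_derive (z : C) 1 phi (P z).
Hypothesis dL : is_derive x 1 L L1.
Hypothesis dP : is_derive x 1 P P1.
Hypothesis dy : \forall z \near x, derivable y (phi z) 1.
Hypothesis ddy : derivable (derive1 y) (phi x) 1.

Let G z := t z * y (phi z).
Let G1 z := t z * (L z * y (phi z) + P z * derive1 y (phi z)).
Let G2 := t x * ((L x ^+ 2 + L1) * y (phi x)
  + (2 * L x * P x + P1) * derive1 y (phi x)
  + P x ^+ 2 * derive1 (derive1 y) (phi x)).

Lemma pullback_derive1 : \forall z \near x, is_derive (z : C) 1 G (G1 z).
Proof.
near=> z; have dyz : derivable y (phi z) 1 by near: z.
have dtz : is_derive z 1 t (L z * t z) by near: z.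
have dphiz : is_derive z 1 phi (P z) by near: z.
have := is_derive_mul dtz (is_derive_chain (derivable_derive1 dyz) dphiz).
by congr is_derive; rewrite /G1; ring.
Unshelve. all: by end_near. Qed.

Lemma pullback_derive2 : is_derive x 1 (derive1 G) G2.
Proof.
apply: (@near_eq_is_derive _ _ _ G1).
  by near=> z; symmetry; apply: derive1_val; near: z; exact: pullback_derive1.
have dtx := nbhs_singleton dt; have dphix := nbhs_singleton dphi.
have dyx := derivable_derive1 (nbhs_singleton dy).
have := is_derive_mul dtx (is_derive_add
  (is_derive_mul dL (is_derive_chain dyx dphix))
  (is_derive_mul dP (is_derive_chain (derivable_derive1 ddy) dphix))).
by congr is_derive; rewrite /G2; ring.
Unshelve. all: by end_near. Qed.

Lemma pullback_twice_derivable :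
  derivable G x 1 /\ derivable (derive1 G) x 1.
Proof.
split.
  by have [] := nbhs_singleton pullback_derive1.
by have [] := pullback_derive2.
Qed.

(** With t' = L t, both derivatives of t (y o phi) are multiples of t. The three hypotheses say that
    the coefficients of y'', y' and y at phi x are k times those of the original operator. *)
Lemma pullback_hyp_op (a b c a' b' c' k : C) :
  x * (1 - x) * P x ^+ 2 = k * (phi x * (1 - phi x)) ->
  x * (1 - x) * (2 * L x * P x + P1) + (c' - (a' + b' + 1) * x) * P x =
    k * (c - (a + b + 1) * phi x) ->
  x * (1 - x) * (L x ^+ 2 + L1) + (c' - (a' + b' + 1) * x) * L x - a' * b' =
    - k * (a * b) ->
  hyp_op a' b' c' G x = t x * k * hyp_op a b c y (phi x).
Proof.
move=> e2 e1 e0; rewrite /hyp_op /=.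
rewrite (derive1_val pullback_derive2) (derive1_val (nbhs_singleton pullback_derive1)).
rewrite /G2 /G1 /G.
transitivity (t x * ((x * (1 - x) * P x ^+ 2) * derive1 (derive1 y) (phi x)
  + (x * (1 - x) * (2 * L x * P x + P1) + (c' - (a' + b' + 1) * x) * P x)
     * derive1 y (phi x)
  + (x * (1 - x) * (L x ^+ 2 + L1) + (c' - (a' + b' + 1) * x) * L x - a' * b')
     * y (phi x))).
  by ring.
by rewrite e2 e1 e0; ring.
Qed.

End Pullback.

(** * Logarithmic derivative of a branch of a rational power *)

Section PowerBranch.
Variable R : realType.
Local Notation C := (cplx R).

(** Continuity and the equation g^n = f^m, where r = m / n, force g' = r (f' / f) g, whichever
    branch g is. *)
Lemma power_branch_derive (U : set C) (f g : C -> C) (r : rat) (x a : C) :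
  open U -> U x -> power_branch U f r g -> is_derive x 1 f a ->
  g x != 0 /\ is_derive x 1 g (ratr r * (a / f x) * g x).
Proof.
move=> oU Ux brg; have [fx0 gc _] := brg _ Ux.
have [n nE] : exists n, denq r = n.+1%:Z.
  by have := denq_gt0 r; case: (denq r) => // -[|n] // _; exists n.
rewrite (_ : ratr r = (numq r)%:~R / n.+1%:R); last by rewrite /ratr nE.
apply: is_derive_exprz_root => //; near=> z.
have /brg[_ _] : U z by near: z; exact: open_nbhs_nbhs.
by rewrite nE.
Unshelve. all: by end_near. Qed.

End PowerBranch.

(** * Power series with geometrically bounded coefficients *)

Section PowerSeries.
Variable K : numFieldType.
Implicit Types (u v : nat -> K) (z w l : K).

Definition psum u z : K := limn (series (fun n => u n * z ^+ n)).

Definition pcvg u z l := series (fun n => u n * z ^+ n) @ \oo --> l.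

Definition pdiff u : nat -> K := fun n => n.+1%:R * u n.+1.

(** Amounts to a positive radius of convergence. *)
Definition geo_bounded u :=
  exists A r : K, [/\ 0 <= A, 0 < r & forall n, `|u n| <= A * r ^+ n].

Lemma pcvg_psum u z l : pcvg u z l -> psum u z = l.
Proof. exact: cvg_lim. Qed.

Lemma pcvg_unique u z l l' : pcvg u z l -> pcvg u z l' -> l = l'.
Proof. by move=> ul ul'; rewrite -(pcvg_psum ul) (pcvg_psum ul'). Qed.

Lemma pcvgD u v z l l' : pcvg u z l -> pcvg v z l' ->
  pcvg (fun n => u n + v n) z (l + l').
Proof.
move=> ul vl; rewrite /pcvg.
have -> : (fun n => (u n + v n) * z ^+ n) =
    (fun n => u n * z ^+ n) + (fun n => v n * z ^+ n).
  by apply/funext => n; rewrite mulrDl.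
by rewrite seriesD; exact: cvgD ul vl.
Qed.

Lemma pcvgZ k u z l : pcvg u z l -> pcvg (fun n => k * u n) z (k * l).
Proof.
move=> ul; rewrite /pcvg.
have -> : (fun n => k * u n * z ^+ n) = k *: (fun n => u n * z ^+ n).
  by apply/funext => n; rewrite -mulrA.
by rewrite seriesZ; exact: cvgZl_tmp ul.
Qed.

Lemma pcvg_euler u z l : pcvg (pdiff u) z l ->
  pcvg (fun n => n%:R * u n) z (z * l).
Proof.
move=> ul; rewrite /pcvg -(cvg_shiftS _).
have -> : (fun n => series (fun n => n%:R * u n * z ^+ n) n.+1) =
    (fun n => z * series (fun n => pdiff u n * z ^+ n) n).
  apply/funext => n; rewrite /series /= big_nat_recl // mul0r mul0r add0r big_distrr /=.
  by apply: eq_bigr => i _; rewrite /pdiff exprS; ring.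
by apply: cvgM => //; exact: cvg_cst.
Qed.

(** The new factor n + 1 is at most 2^n, so doubling the ratio absorbs it. *)
Lemma geo_bounded_pdiff u : geo_bounded u -> geo_bounded (pdiff u).
Proof.
move=> [A [r [A0 r0 uE]]]; exists (A * r), (2 * r); split.
- by rewrite mulr_ge0 // ltW.
- by rewrite mulr_gt0.
move=> n; rewrite /pdiff normrM normr_nat.
apply: le_trans (ler_wpM2l _ (uE n.+1)) _ => //.
have -> : n.+1%:R * (A * r ^+ n.+1) = A * r * (n.+1%:R * r ^+ n).
  by rewrite exprS; ring.
rewrite exprMn ler_wpM2l ?mulr_ge0 ?(ltW r0)// ler_wpM2r ?exprn_ge0 ?(ltW r0)//.
by rewrite -natrX ler_nat ltn_expl.
Qed.

Lemma cvg_norm_le (v : nat -> K) l (B : K) :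
  v @ \oo --> l -> (forall n, `|v n| <= B) -> `|l| <= B.
Proof.
move=> vl vB; apply/ler_addgt0Pr => e e0.
have /cvgrPdist_le/(_ e e0)[N _ NE] := vl.
rewrite -(subrK (v N) l) addrC; apply: le_trans (ler_normD _ _) _.
by apply: lerD => //; exact: NE (leqnn N).
Qed.

(** A quadratic error bound, unlike a limit of difference quotients, passes from partial sums to
    their limit; series are thus differentiated termwise with no exchange of limits. *)
Lemma is_derive_quadratic (f : K -> K) z l (M : K) :
  (\forall w \near z, `|f w - f z - (w - z) * l| <= M * `|w - z| ^+ 2) ->
  is_derive z 1 f l.
Proof.
move=> fE; pose g w := if w == z then l else (f w - f z) / (w - z).
have gz : g z = l by rewrite /g eqxx.
rewrite -gz; apply: near_is_derive_caratheodory.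
  suff : g w @[w --> z] --> l by rewrite /prop_for /continuous_at gz.
  apply/(@cvgrPdist_le _ _ _ (nbhs z)) => e e0.
  have M0 : 0 < `|M| + 1 by rewrite ltr_wpDl.
  near=> w; rewrite /g; case: eqVneq => [_|wz].
    by rewrite subrr normr0 ltW.
  have wz0 : 0 < `|w - z| by rewrite normr_gt0 subr_eq0.
  rewrite -(ler_pM2r wz0) -normrM mulrBl divfK ?subr_eq0 // [l * _]mulrC [`|_ * l - _|]distrC.
  apply: le_trans (_ : `|M * `|w - z| ^+ 2| <= _).
    have h : `|f w - f z - (w - z) * l| <= M * `|w - z| ^+ 2 by near: w.
    rewrite [`|M * _|]ger0_norm; first exact: h.
    by apply: le_trans h.
  rewrite normrM normrX normr_id expr2 mulrA ler_wpM2r //.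
  apply: le_trans (_ : (`|M| + 1) * `|w - z| <= _).
    by rewrite ler_wpM2r // lerDl.
  rewrite mulrC -ler_pdivlMr //.
  by near: w; apply: cvgr_distC_le; [exact: cvg_id|rewrite divr_gt0].
near=> w; rewrite /g; case: eqVneq => [->|wz]; first by rewrite !subrr mulr0.
by rewrite divfK // subr_eq0.
Unshelve. all: by end_near. Qed.

Definition taylor_rem n z w : K := w ^+ n - z ^+ n - (w - z) * (n%:R * z ^+ n.-1).

Lemma taylor_remS n z w :
  taylor_rem n.+1 z w = w * taylor_rem n z w + (w - z) ^+ 2 * (n%:R * z ^+ n.-1).
Proof.
rewrite /taylor_rem; case: n => [|n]; first by rewrite /= !expr0 expr1 mul0r; ring.
by rewrite /= !exprS -[n.+2%:R]natr1 -[n.+1%:R]natr1; ring.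
Qed.

(** The factor rho^2 on the left avoids the exponent n - 2. In the induction 4^(n+1) splits as 4^n,
    for the previous remainder, plus 3 * 4^n, which dominates the new factor n. *)
Lemma taylor_rem_le n z w (rho : K) : `|z| <= rho -> `|w| <= rho ->
  `|taylor_rem n z w| * rho ^+ 2 <= `|w - z| ^+ 2 * (4 * rho) ^+ n.
Proof.
move=> zr wr; have r0 : 0 <= rho by exact: le_trans zr.
have sq0 : 0 <= `|w - z| ^+ 2 by rewrite exprn_ge0.
elim: n => [|n ih].
  by rewrite /taylor_rem !expr0 subrr mul0r mulr0 subrr normr0 mul0r mulr1.
rewrite taylor_remS; apply: le_trans (ler_wpM2r _ (ler_normD _ _)) _.
  by rewrite exprn_ge0.
rewrite mulrDl [`|w * _|]normrM [`|_ ^+ 2 * _|]normrM [`|_%:R * _|]normrM.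
rewrite !normrX normr_nat.
have -> : `|w - z| ^+ 2 * (4 * rho) ^+ n.+1 =
    rho * (`|w - z| ^+ 2 * (4 * rho) ^+ n) +
    `|w - z| ^+ 2 * (3 * 4 ^+ n * rho ^+ n.+1).
  by rewrite !exprMn !exprS; ring.
apply: lerD.
  rewrite -mulrA; apply: le_trans (ler_wpM2r _ wr) _; first by rewrite mulr_ge0 ?exprn_ge0.
  by rewrite ler_wpM2l.
rewrite -mulrA ler_wpM2l //.
case: n {ih} => [|n]; first by rewrite !mul0r !mulr_ge0 ?exprn_ge0.
have -> : n.+1%:R * `|z| ^+ n.+1.-1 * rho ^+ 2 = n.+1%:R * (`|z| ^+ n * rho ^+ 2) by rewrite mulrA.
apply: ler_pM => //; first by rewrite mulr_ge0 ?exprn_ge0.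
  apply: le_trans (_ : 4 ^+ n.+1 <= _); last by rewrite ler_peMl ?exprn_ge0 ?ler1n.
  by rewrite -natrX ler_nat ltnW // ltn_expl.
rewrite -(addn2 n) exprD ler_wpM2r ?exprn_ge0 // lerXn2r // nnegrE //.
Qed.

(** The form in which completeness is used; it is established for [cplx R] in [complex_geo_cvg]. *)
Hypothesis geo_cvg : forall (v : nat -> K) (A : K), 0 <= A ->
  (forall n, `|v n| <= A * 2^-1 ^+ n) -> cvgn (series v).

Lemma psum_pcvg u A r z : 0 <= A -> 0 < r ->
  (forall n, `|u n| <= A * r ^+ n) -> r * `|z| <= 2^-1 -> pcvg u z (psum u z).
Proof.
move=> A0 r0 uE rz; apply: (geo_cvg A0) => n.
rewrite normrM normrX; apply: le_trans (ler_wpM2r _ (uE n)) _.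
  by rewrite exprn_ge0.
by rewrite -mulrA -exprMn ler_wpM2l // lerXn2r ?nnegrE ?invr_ge0 ?mulr_ge0 ?(ltW r0).
Qed.

Lemma near0_scaled_le (r e : K) : 0 < r -> 0 < e -> \forall z \near (0 : K), r * `|z| < e.
Proof.
move=> r0 e0; near=> z.
rewrite mulrC -ltr_pdivlMr // -[z]subr0 distrC.
by near: z; apply: cvgr_dist_lt; [exact: cvg_id|rewrite divr_gt0].
Unshelve. all: by end_near. Qed.

Lemma near_pcvg u : geo_bounded u -> \forall z \near (0 : K), pcvg u z (psum u z).
Proof.
move=> [A [r [A0 r0 uE]]]; near=> z.
apply: (psum_pcvg A0 r0 uE); apply: ltW; near: z.
by apply: near0_scaled_le; rewrite ?invr_gt0.
Unshelve. all: by end_near. Qed.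

Lemma geo_sum_le (q : K) n : 0 <= q -> q <= 2^-1 -> \sum_(0 <= i < n) q ^+ i <= 2.
Proof.
move=> q0 q2; apply: le_trans (_ : 2 - 2 * 2^-1 ^+ n <= 2); last first.
  by rewrite lerBlDr lerDl mulr_ge0 // exprn_ge0 // invr_ge0.
elim: n => [|n ih]; first by rewrite big_geq // expr0 mulr1 subrr.
rewrite big_nat_recr //=; apply: le_trans (lerD ih (_ : q ^+ n <= 2^-1 ^+ n)) _.
  by rewrite lerXn2r ?nnegrE ?invr_ge0.
by rewrite exprS mulrA divff ?pnatr_eq0 // mul1r le_eqVlt; apply/orP; left; apply/eqP; ring.
Qed.

Lemma near_is_derive_psum u : geo_bounded u ->
  \forall z \near (0 : K), is_derive (z : K) 1 (psum u) (psum (pdiff u) z).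
Proof.
move=> ub; have [A [r [A0 r0 uE]]] := ub.
(* With this radius 4 r rho = 1/2, so the bounds on the Taylor remainders form a geometric series of
   sum at most 2. *)
pose rho : K := (8 * r)^-1.
have rho0 : 0 < rho by rewrite invr_gt0 mulr_gt0.
have cvgu z : `|z| <= rho -> pcvg u z (psum u z).
  move=> zr; apply: (psum_pcvg A0 r0 uE).
  rewrite mulrC -ler_pdivlMr // (le_trans zr) // /rho invfM ler_wpM2r ?invr_ge0 ?(ltW r0) //.
  by rewrite lef_pV2 ?posrE // ler_nat.
near=> z.
have zrho : `|z| < rho by rewrite -[`|z|]mul1r; near: z; exact: near0_scaled_le.
apply: (@is_derive_quadratic _ _ _ (A * 2 / rho ^+ 2)); near=> w.
have wr : `|w| <= rho.
  apply: ltW; near: w; move: zrho => /(cvgr_norm_lt z); apply; exact: cvg_id.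
have zr := ltW zrho.
rewrite mulrAC ler_pdivlMr ?exprn_gt0 //.
have du : pcvg (pdiff u) z (psum (pdiff u) z) by near: z; exact/near_pcvg/geo_bounded_pdiff.
have -> : `|psum u w - psum u z - (w - z) * psum (pdiff u) z| * rho ^+ 2 =
    `|(psum u w - psum u z - (w - z) * psum (pdiff u) z) * rho ^+ 2|.
  by rewrite normrM [`|rho ^+ 2|]ger0_norm // exprn_ge0 // ltW.
(* The constant term has no remainder: n + 1 terms of u are matched with n terms of [pdiff u]. *)
pose v n : K := (\sum_(0 <= i < n.+1) u i * taylor_rem i z w) * rho ^+ 2.
apply: (@cvg_norm_le v).
  have -> : v = (fun n => (series (fun n => u n * w ^+ n) n.+1
      - series (fun n => u n * z ^+ n) n.+1
      - (w - z) * series (fun n => pdiff u n * z ^+ n) n) * rho ^+ 2).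
    apply/funext => n; rewrite /v; congr (_ * _).
    rewrite /series /= -sumrB big_distrr /= big_nat_recl // [in RHS]big_nat_recl //.
    have -> : taylor_rem 0 z w = 0 by rewrite /taylor_rem !expr0; ring.
    rewrite -addrA -sumrB mulr0 !expr0 subrr !add0r; apply: eq_bigr => i _.
    by rewrite /taylor_rem /pdiff /=; ring.
  apply: cvgM; last exact: cvg_cst.
  apply: cvgB; last by apply: cvgM => //; exact: cvg_cst.
  by apply: cvgB; rewrite (cvg_shiftS (series _)); exact: cvgu.
move=> n; rewrite /v normrM [`|rho ^+ 2|]ger0_norm ?exprn_ge0 ?(ltW rho0) //.
apply: le_trans (ler_wpM2r _ (ler_norm_sum _ _ _)) _.
  by rewrite exprn_ge0 // ltW.
rewrite big_distrl /=.
apply: le_trans (_ : \sum_(0 <= i < n.+1) A * `|w - z| ^+ 2 * (4 * (r * rho)) ^+ i <= _).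
  apply: ler_sum => i _; rewrite normrM -mulrA.
  apply: le_trans (ler_pM _ _ (uE i) (taylor_rem_le i zr wr)) _ => //.
    by rewrite mulr_ge0 // exprn_ge0 // ltW.
  by rewrite mulrACA -exprMn (mulrCA r).
rewrite -big_distrr /= mulrAC ler_wpM2r ?exprn_ge0 // ler_wpM2l //.
have -> : 4 * (r * rho) = 2^-1.
  by rewrite /rho; field; rewrite gt_eqF.
by apply: geo_sum_le; rewrite ?invr_ge0.
Unshelve. all: by end_near. Qed.

End PowerSeries.

Arguments pcvgZ {K} k {u z l}.

Lemma near_dist_lt (K : numFieldType) (x e : K) : 0 < e ->
  \forall y \near x, `|x - y| < e.
Proof. by move=> e0; apply: (@cvgr_dist_lt K K K (nbhs x) _ id x) => //; exact: cvg_id. Qed.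

(** * Power series solutions of the hypergeometric equation *)

Section HypergeometricSeries.
Variable K : numFieldType.
Hypothesis geo_cvg : forall (v : nat -> K) (A : K), 0 <= A ->
  (forall n, `|v n| <= A * 2^-1 ^+ n) -> cvgn (series v).

Definition hyp_rec (a b c : K) (u : nat -> K) := forall n,
  n.+1%:R * (c + n%:R) * u n.+1 = (a + n%:R) * (b + n%:R) * u n.

Lemma near_derive1_psum (u : nat -> K) : geo_bounded u ->
  \forall z \near (0 : K), [/\ is_derive (z : K) 1 (psum u) (psum (pdiff u) z)
    & is_derive (z : K) 1 (derive1 (psum u)) (psum (pdiff (pdiff u)) z)].
Proof.
move=> ub; have d1 := near_is_derive_psum geo_cvg ub.
have d2 := near_is_derive_psum geo_cvg (geo_bounded_pdiff ub).
have d11 := near_join d1.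
near=> z; split; first by near: z.
apply: (@near_eq_is_derive _ _ _ (psum (pdiff u))); last by near: z.
have : \forall w \near z, is_derive (w : K) 1 (psum u) (psum (pdiff u) w) by near: z.
by apply: filterS => w /derive1_val.
Unshelve. all: by end_near. Qed.

(** The operator sends the series of u to the series with coefficients (n + 1)(c + n) u_(n+1) - (a +
    n)(b + n) u_n, where (a + n)(b + n) is expanded as n^2 + (a + b) n + a b. *)
Lemma near_hyp_op_psum (a b c : K) (u : nat -> K) : geo_bounded u ->
  hyp_rec a b c u ->
  \forall z \near (0 : K), [/\ derivable (psum u) z 1,
    derivable (derive1 (psum u)) z 1 & hyp_op a b c (psum u) z = 0].
Proof.
move=> ub urec; have dub := geo_bounded_pdiff ub.
have near_p0 := near_pcvg geo_cvg ub.
have near_p1 := near_pcvg geo_cvg dub.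
have near_p2 := near_pcvg geo_cvg (geo_bounded_pdiff dub).
near=> z.
have [d1 d2] : [/\ is_derive (z : K) 1 (psum u) (psum (pdiff u) z)
    & is_derive (z : K) 1 (derive1 (psum u)) (psum (pdiff (pdiff u)) z)].
  by near: z; exact: near_derive1_psum.
have p0 : pcvg u z (psum u z) by near: z.
have p1 : pcvg (pdiff u) z (psum (pdiff u) z) by near: z.
have p2 : pcvg (pdiff (pdiff u)) z (psum (pdiff (pdiff u)) z) by near: z.
split; [by case: d1|by case: d2|].
rewrite /hyp_op /= (derive1_val d1) (derive1_val d2).
have e2 := pcvg_euler p2.
have e0 := pcvg_euler p1.
set F0 := psum u z in p0 *; set F1 := psum (pdiff u) z in p1 e0 *.
set F2 := psum _ z in p2 e2 *.
(* [n ^ 2 u_n] comes from the square of the Euler operator [z d/dz]. *)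
have e3 : pcvg (fun n => n%:R * (n%:R * u n)) z (z * (z * F2 + F1)).
  apply: pcvg_euler.
  have := pcvgD e2 p1; congr (pcvg _ _ _); apply/funext => n.
  by rewrite /pdiff -natr1; ring.
have := pcvgD (pcvgD (pcvgD (pcvgD e2 (pcvgZ c p1)) (pcvgZ (-1) e3))
  (pcvgZ (- (a + b)) e0)) (pcvgZ (- (a * b)) p0).
set u' := (fun n => _); set L := (X in pcvg _ _ X) => eL.
(* The zero sequence is written as a multiple of u, so that [pcvgZ] gives it the sum 0. *)
have u'0 : u' = fun n => 0 * u n.
  apply/funext => n; rewrite /u' /pdiff mul0r.
  transitivity (n.+1%:R * (c + n%:R) * u n.+1 - (a + n%:R) * (b + n%:R) * u n).
    by ring.
  by rewrite urec subrr.
have L0 : L = 0.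
  by rewrite u'0 in eL; rewrite (pcvg_unique eL (pcvgZ 0 p0)) mul0r.
by rewrite -[RHS]L0 /L; ring.
Unshelve. all: by end_near. Qed.

(** Under these bounds (a + n)(b + n) <= (n + 1)(c + n), so all coefficients have modulus at most 1.
    The four hypergeometric functions of the identities and the binomial series below are
    covered. *)
Lemma hyp_rec_bounded (a b c : K) (u : nat -> K) :
  0 <= a -> a <= c -> 0 <= b -> b <= 1 -> 0 < c -> u 0 = 1 ->
  hyp_rec a b c u -> geo_bounded u.
Proof.
move=> a0 ac b0 b1 c0 u0 urec; exists 1, 1; split=> // n.
rewrite expr1n mulr1; elim: n => [|n ih]; first by rewrite u0 normr1.
have cn0 : 0 < n.+1%:R * (c + n%:R) by rewrite mulr_gt0 ?ltr0n ?ltr_wpDr.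
rewrite -(ler_pM2l cn0) mulr1 -{1}(ger0_norm (ltW cn0)) -normrM urec normrM.
rewrite -[leRHS]mulr1; apply: ler_pM => //.
rewrite ger0_norm ?mulr_ge0 ?addr_ge0 //.
by rewrite mulrC -natr1 [n%:R + 1]addrC ler_pM ?addr_ge0 ?lerD2r.
Qed.

End HypergeometricSeries.

(** * Real and imaginary parts, and convergence of complex series *)

Section ComplexTopology.
Variable R : realType.
Local Notation C := (cplx R).

Lemma contracting_continuous (p : C -> R) :
  (forall x y, p (x - y) = p x - p y) -> (forall z, `|p z|%:C%C <= `|z|) ->
  continuous p.
Proof.
move=> pB p_le x; apply/(@cvgrPdist_lt _ _ _ (nbhs x)) => e e0.
have e0' : 0 < e%:C%C :> C by rewrite ltcR.
have near_e := near_dist_lt x e0'.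
near=> y; rewrite -ltcR -pB.
by apply: le_lt_trans (p_le _) _; near: y; exact: near_e.
Unshelve. all: by end_near. Qed.

Lemma normc_ge_Im (z : C) : `|complex.Im z|%:C%C <= `|z|.
Proof.
have := normc_ge_Re (z * 'i%C); rewrite ReiNIm normrN normrM.
by rewrite [`|'i%C|]normc_def /= expr0n expr1n add0r sqrtr1 mulr1.
Qed.

Lemma Re_continuous : continuous (@complex.Re R : C -> R).
Proof. by apply: contracting_continuous => [x y|]; [exact: raddfB|exact: normc_ge_Re]. Qed.

Lemma Im_continuous : continuous (@complex.Im R : C -> R).
Proof. by apply: contracting_continuous => [x y|]; [exact: raddfB|exact: normc_ge_Im]. Qed.

Lemma real_complex_continuous : continuous (fun x : R => x%:C%C : C).
Proof.
move=> x; apply/(@cvgrPdist_lt _ _ _ (nbhs x)) => e e0.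
have er : e \is Num.real by exact: gtr0_real.
have e0' : 0 < complex.Re e by rewrite -ltcR RRe_real.
have near_e := near_dist_lt x e0'.
near=> y; rewrite -rmorphB /= normc_def /= expr0n addr0 sqrtr_sqr -(RRe_real er) ltcR.
by near: y; exact: near_e.
Unshelve. all: by end_near. Qed.

(** Discharges [geo_cvg]: the real and imaginary parts are dominated by the same real geometric
    series. *)
Lemma complex_geo_cvg (v : nat -> C) (A : C) : 0 <= A ->
  (forall n, `|v n| <= A * 2^-1 ^+ n) -> cvgn (series v).
Proof.
move=> A0 vA.
have AE : A = (complex.Re A)%:C%C by rewrite RRe_real // ger0_real.
have cvgR (w : nat -> R) : (forall n, `|w n|%:C%C <= `|v n|) -> cvgn (series w).
  move=> wv; apply: normed_cvg.
  apply: (@series_le_cvg _ _ (geometric (complex.Re A) 2^-1)) => [n|n|n|].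
  - exact: normr_ge0.
  - by rewrite /geometric /= mulr_ge0 ?exprn_ge0 ?invr_ge0 // -ler0c -AE.
  - rewrite /geometric /= -lecR (le_trans (wv n)) // (le_trans (vA n)) //.
    have -> : (2^-1 : C) = (2^-1)%:C%C by rewrite fmorphV rmorph_nat.
    by rewrite [in leLHS]AE -rmorphXn -rmorphM.
  - by apply: is_cvg_geometric_series; rewrite ger0_norm ?invr_ge0 // invf_lt1 ?ltr1n.
have cRe := cvgR (fun n => complex.Re (v n)) (fun n => normc_ge_Re _).
have cIm := cvgR (fun n => complex.Im (v n)) (fun n => normc_ge_Im _).
have -> : series v = (fun n => (series (fun n => complex.Re (v n)) n)%:C%C
    + 'i%C * (series (fun n => complex.Im (v n)) n)%:C%C).
  apply/funext => n; rewrite /series /= !rmorph_sum big_distrr -big_split /=.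
  by apply: eq_bigr => i _; exact: complexE.
apply: is_cvgD; last apply: is_cvgM; first last.
- exact: (cvgP _ (continuous_cvg _ (@real_complex_continuous _) cIm)).
- exact: is_cvg_cst.
- exact: (cvgP _ (continuous_cvg _ (@real_complex_continuous _) cRe)).
Qed.

End ComplexTopology.

(** * Uniqueness of the regular solution at 0 *)

Lemma continuous_near_neq0 (K : numFieldType) (f : K -> K) (x : K) :
  {for x, continuous f} -> f x != 0 -> \forall z \near x, f z != 0.
Proof. move=> fc fx0; exact: (@cvgr_neq0 _ _ _ (nbhs x) _ f (f x)). Qed.

Lemma is_derive_near_neq0 (K : numFieldType) (f : K -> K) (x a : K) :
  is_derive x 1 f a -> f x != 0 -> \forall z \near x, f z != 0.
Proof. by move=> /is_derive_continuous; exact: continuous_near_neq0. Qed.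

Lemma is_derive_var (K : numFieldType) (x : K) : is_derive x 1 (fun z => z) 1.
Proof. exact: is_derive_id. Qed.

(* Stated on values rather than functions: [ring] compares its atoms up to
   conversion, which is costly on derivatives. *)
Lemma wronskian_algebra (K : fieldType) (x a b c f f1 f2 g g1 g2 : K) : x != 1 ->
  x * (1 - x) * f2 + (c - (a + b + 1) * x) * f1 - a * b * f = 0 ->
  x * (1 - x) * g2 + (c - (a + b + 1) * x) * g1 - a * b * g = 0 ->
  x * (f * g2 - f2 * g) = - ((c - (a + b + 1) * x) / (1 - x) * (f * g1 - f1 * g)).
Proof.
move=> x1 eF eG; have x1' : 1 - x != 0 by rewrite subr_eq0 eq_sym.
have clear_denominator A W : (1 - x) * - (A / (1 - x) * W) = - (A * W).
  by rewrite mulrN mulrCA mulrA divfK.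
apply: (mulfI x1'); rewrite clear_denominator; apply: subr0_eq.
transitivity (f * (x * (1 - x) * g2 + (c - (a + b + 1) * x) * g1 - a * b * g) -
  (x * (1 - x) * f2 + (c - (a + b + 1) * x) * f1 - a * b * f) * g).
  by ring.
by rewrite eF eG mul0r mulr0 subr0.
Qed.

(** At the singular point 0 the equation degenerates to c y'(0) = a b y(0): the value at 0
    determines the derivative. *)
Lemma wronskian_algebra_init (K : fieldType) (x a b c f f1 f2 g g1 g2 : K) :
  c != 0 -> x = 0 -> f = 1 -> g = 1 ->
  x * (1 - x) * f2 + (c - (a + b + 1) * x) * f1 - a * b * f = 0 ->
  x * (1 - x) * g2 + (c - (a + b + 1) * x) * g1 - a * b * g = 0 ->
  f * g1 - f1 * g = 0.
Proof.
move=> c0 -> -> ->; rewrite !(mul0r, mulr0, subr0, add0r, mulr1, mul1r).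
move=> /subr0_eq eF /subr0_eq eG; apply: (mulfI c0).
by rewrite mulr0 mulrBr eG eF subrr.
Qed.

Definition wronskian (K : numFieldType) (F G : K -> K) (x : K) : K :=
  F x * derive1 G x - derive1 F x * G x.

Definition wronskian_deriv (K : numFieldType) (F G : K -> K) (x : K) : K :=
  F x * derive1 (derive1 G) x - derive1 (derive1 F) x * G x.

Section Wronskian.
Variables (K : numFieldType) (F G : K -> K) (x : K).
Hypotheses (dF : derivable F x 1) (dG : derivable G x 1).

Lemma is_derive_wronskian :
  derivable (derive1 F) x 1 -> derivable (derive1 G) x 1 ->
  is_derive x 1 (wronskian F G) (wronskian_deriv F G x).
Proof.
move=> ddF ddG; have := is_derive_sub
  (is_derive_mul (derivable_derive1 dF) (derivable_derive1 ddG))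
  (is_derive_mul (derivable_derive1 ddF) (derivable_derive1 dG)).
have cancel (u v w : K) : u + v - (w + u) = v - w by ring.
by rewrite cancel.
Qed.

Lemma wronskian_ode (a b c : K) : x != 1 ->
  hyp_op a b c F x = 0 -> hyp_op a b c G x = 0 ->
  x * wronskian_deriv F G x =
  - ((c - (a + b + 1) * x) / (1 - x) * wronskian F G x).
Proof. exact: wronskian_algebra. Qed.

Lemma is_derive_quotient : F x != 0 ->
  is_derive x 1 (fun w => G w / F w)
    (wronskian F G x / F x ^+ 2).
Proof.
move=> Fx; have := is_derive_div Fx (derivable_derive1 dG) (derivable_derive1 dF).
by congr is_derive; rewrite [derive1 G x * _]mulrC [G x * _]mulrC.
Qed.

Lemma wronskian_init (a b c : K) : c != 0 -> x = 0 -> F x = 1 -> G x = 1 ->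
  hyp_op a b c F x = 0 -> hyp_op a b c G x = 0 ->
  wronskian F G x = 0.
Proof. exact: wronskian_algebra_init. Qed.

End Wronskian.

(** The left side is the real part of - q w times the conjugate of w, that is - Re(q) |w|^2. *)
Lemma complex_neg_pairing (R : realType) (q w : R[i]) : 0 <= complex.Re q ->
  complex.Re (- (q * w)) * complex.Re w + complex.Im (- (q * w)) * complex.Im w <= 0.
Proof.
case: q w => qr qi [wr wi] /= qr0.
have := mulr_ge0 qr0 (addr_ge0 (sqr_ge0 wr) (sqr_ge0 wi)).
by rewrite -oppr_le0; congr (_ <= _); ring.
Qed.

Section Uniqueness.
Variable R : realType.
Local Notation C := (cplx R).

Lemma ray_continuous (x0 : C) : continuous (fun s : R => s%:C%C * x0 : C).
Proof.
move=> s; apply: continuousM; first exact: real_complex_continuous.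
exact: cst_continuous.
Qed.

(** Meant for p = Re and p = Im: a Caratheodory factor of V, multiplied by x0 and projected by p, is
    one for the real function along the ray. *)
Lemma is_derive_ray (p : C -> R) (V : C -> C) (x0 : C) (s : R) (l : C) :
  additive p -> continuous p -> (forall (t : R) (z : C), p (t%:C%C * z) = t * p z) ->
  is_derive (s%:C%C * x0 : C) 1 V l ->
  is_derive s 1 (fun t : R => p (V (t%:C%C * x0))) (p (x0 * l)).
Proof.
move=> padd pcont pZ /is_derive_caratheodory[g [gE gc <-]].
apply/is_derive_caratheodory.
exists (fun t : R => p (x0 * g (t%:C%C * x0))); split=> //.
- move=> t; rewrite -padd gE -mulrBl -rmorphB mulrCA pZ mulrC.
  by rewrite [g _ * _]mulrC.
- apply: (@continuous_comp _ _ _ (fun t : R => x0 * g (t%:C%C * x0) : C) p).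
    apply: continuousM; first exact: cst_continuous.
    by apply: (@continuous_comp _ _ _ (fun t : R => t%:C%C * x0 : C) g);
      first exact: ray_continuous.
  exact: pcont.
Qed.

(** On x = s x0 the second hypothesis reads s d/ds |V|^2 <= 0. It bears on x V1, for s > 0, because
    the equation of the Wronskian is singular at 0 and gives x W' rather than W'. A nonnegative
    nonincreasing function that starts at 0 is zero. *)
Lemma ray_vanishing (V V1 : C -> C) (x0 : C) :
  (forall s : R, 0 <= s -> s <= 1 ->
     is_derive (s%:C%C * x0 : C) 1 V (V1 (s%:C%C * x0))) ->
  (forall (s : R) (x : C), 0 < s -> s < 1 -> x = s%:C%C * x0 ->
     complex.Re (x * V1 x) * complex.Re (V x)
     + complex.Im (x * V1 x) * complex.Im (V x) <= 0) ->
  V 0 = 0 -> V x0 = 0.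
Proof.
move=> dV V1le V0.
pose a (s : R) := complex.Re (V (s%:C%C * x0)).
pose b (s : R) := complex.Im (V (s%:C%C * x0)).
have ReZ (t : R) (z : C) : complex.Re (t%:C%C * z) = t * complex.Re z.
  by case: z => zr zi /=; rewrite mul0r subr0.
have ImZ (t : R) (z : C) : complex.Im (t%:C%C * z) = t * complex.Im z.
  by case: z => zr zi /=; rewrite mul0r addr0.
have da s : 0 <= s -> s <= 1 ->
    is_derive (s : R) 1 a (complex.Re (x0 * V1 (s%:C%C * x0))).
  move=> s0 s1; apply: is_derive_ray => //; [|exact: Re_continuous|exact: dV].
  by move=> u v; exact: raddfB.
have db s : 0 <= s -> s <= 1 ->
    is_derive (s : R) 1 b (complex.Im (x0 * V1 (s%:C%C * x0))).
  move=> s0 s1; apply: is_derive_ray => //; [|exact: Im_continuous|exact: dV].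
  by move=> u v; exact: raddfB.
pose e s := a s * a s + b s * b s.
pose e1 (s : R) := 2 * (complex.Re (x0 * V1 (s%:C%C * x0)) * a s
   + complex.Im (x0 * V1 (s%:C%C * x0)) * b s).
have de s : 0 <= s -> s <= 1 -> is_derive (s : R) 1 e (e1 s).
  move=> s0 s1.
  have := is_derive_add (is_derive_mul (da s s0 s1) (da s s0 s1))
    (is_derive_mul (db s s0 s1) (db s s0 s1)).
  by congr is_derive; rewrite /e1; ring.
have e10 : e 1 <= e 0.
  apply: (@ler0_derive1_le_cc R e 0 1) => //; rewrite ?in_itv /= ?lexx ?ler01 //.
  - by move=> s; rewrite in_itv /= => /andP[/ltW s0 /ltW s1]; case: (de s s0 s1).
  - move=> s; rewrite in_itv /= => /andP[s0 s1].
    (* Multiplying by s > 0 turns x0 into x = s x0, as in the hypothesis. *)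
    rewrite (derive1_val (de s (ltW s0) (ltW s1))) /e1 -(pmulr_rle0 _ s0).
    have := V1le s _ s0 s1 erefl; rewrite /= -mulrA ReZ ImZ -/(a s) -/(b s) => h.
    have := mulr_ge0_le0 (ler0n R 2) h; congr (_ <= _); ring.
  - apply/continuous_in_subspaceT => s; rewrite inE /= in_itv /= => /andP[s0 s1].
    exact: is_derive_continuous (de s s0 s1).
have e0 : e 0 = 0 by rewrite /e /a /b mul0r V0 /= mul0r addr0.
have /eqP : e 1 = 0.
  apply/eqP; rewrite eq_le -{1}e0 e10 /= /e -!expr2.
  by rewrite addr_ge0 ?sqr_ge0.
rewrite /e -!expr2 paddr_eq0 ?sqr_ge0 // !sqrf_eq0 /a /b mul1r.
by case: (V x0) => r i /= /andP[/eqP-> /eqP->].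
Qed.

(** Balls centred at 0 are star-shaped. *)
Lemma near0_ray (P : C -> Prop) : (\forall z \near (0 : C), P z) ->
  \forall z \near (0 : C), forall s : R, 0 <= s -> s <= 1 -> P (s%:C%C * z).
Proof.
move=> /nbhs_normP[e e0 eP]; apply/nbhs_normP; exists e => // z /= ze s s0 s1.
apply: eP => /=; apply: le_lt_trans ze.
rewrite !sub0r !normrN normrM ler_piMl // ger0_norm ?ler0c //.
by rewrite -[1]/(1%:C%C) lecR.
Qed.

(** The case V1 = 0 of [ray_vanishing], applied to V - V(0). *)
Lemma near0_cst (V : C -> C) : (\forall z \near (0 : C), is_derive (z : C) 1 V 0) ->
  \forall z \near (0 : C), V z = V 0.
Proof.
move=> /near0_ray; apply: filterS => z dV; apply/eqP; rewrite -subr_eq0; apply/eqP.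
apply: (@ray_vanishing (fun w => V w - V 0) (fun=> 0)) => [s s0 s1|s x _ _ _ /=|].
- have := is_derive_sub (dV s s0 s1) (is_derive_const (V 0) (s%:C%C * z)).
  by congr is_derive; rewrite subr0.
- by rewrite mulr0 /= !mul0r addr0.
- by rewrite subrr.
Qed.

Definition near_hyp_solution (a b c : C) (F : C -> C) :=
  \forall z \near (0 : C), [/\ derivable F z 1, derivable (derive1 F) z 1
    & hyp_op a b c F z = 0].

Lemma near_wronskian0 (a b c : C) (F G : C -> C) : 0 < c ->
  near_hyp_solution a b c F -> near_hyp_solution a b c G -> F 0 = 1 -> G 0 = 1 ->
  \forall z \near (0 : C), wronskian F G z = 0.
Proof.
move=> c0 hF hG F0 G0.
pose q z := (c - (a + b + 1) * z) / (1 - z).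
have q0 : q 0 = c by rewrite /q mulr0 !subr0 divr1.
have q_gt0 : \forall z \near (0 : C), z != 1 /\ 0 < complex.Re (q z).
  have z1 : \forall z \near (0 : C), z != 1.
    have := is_derive_near_neq0 (is_derive_sub (is_derive_const (1 : C) 0) (is_derive_var 0)).
    by rewrite subr0 oner_neq0 => /(_ isT); apply: filterS => z; rewrite subr_eq0 eq_sym.
  apply: filterI => //.
  have qc : {for (0 : C), continuous q}.
    apply: is_derive_continuous (is_derive_div _ (is_derive_sub (is_derive_const c 0)
      (is_derive_mul (is_derive_const _ 0) (is_derive_var 0)))
      (is_derive_sub (is_derive_const 1 0) (is_derive_var 0))).
    by rewrite subr0 oner_neq0.
  have Rqc : complex.Re (q z) @[z --> (0 : C)] --> complex.Re (q 0).
    by apply: (continuous_comp qc); exact: Re_continuous.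
  apply: (cvgr_gt _ Rqc); rewrite q0.
  by rewrite -ltcR RRe_real // gtr0_real.
apply: filterS (near0_ray (filterI q_gt0 (filterI hF hG))) => z hz.
apply: (@ray_vanishing (wronskian F G) (wronskian_deriv F G)).
- move=> s s0 s1; have [_ [[dF ddF _] [dG ddG _]]] := hz s s0 s1.
  exact (is_derive_wronskian dF dG ddF ddG).
- move=> s x s0 s1 xE; have := hz s (ltW s0) (ltW s1).
  rewrite -xE => -[[x1 qx] [[_ _ eF] [_ _ eG]]].
  rewrite (wronskian_ode x1 eF eG).
  exact: (complex_neg_pairing _ (ltW qx)).
- have [_ _ eF] := nbhs_singleton hF; have [_ _ eG] := nbhs_singleton hG.
  exact (wronskian_init (lt0r_neq0 c0) erefl F0 G0 eF eG).
Unshelve. all: by end_near. Qed.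

Lemma near_hyp_solution_unique (a b c : C) (F G : C -> C) : 0 < c ->
  near_hyp_solution a b c F -> near_hyp_solution a b c G -> F 0 = 1 -> G 0 = 1 ->
  \forall z \near (0 : C), F z = G z.
Proof.
move=> c0 hF hG F0 G0; have W0 := near_wronskian0 c0 hF hG F0 G0.
have F_neq0 : \forall z \near (0 : C), F z != 0.
  have [/derivable_derive1 dF _ _] := nbhs_singleton hF.
  by apply: (is_derive_near_neq0 dF); rewrite F0 oner_neq0.
have : \forall z \near (0 : C), is_derive (z : C) 1 (fun w => G w / F w) 0.
  near=> z; have Fz : F z != 0 by near: z.
  have [dF _ _] : [/\ derivable F z 1, derivable (derive1 F) z 1
    & hyp_op a b c F z = 0] by near: z.
  have [dG _ _] : [/\ derivable G z 1, derivable (derive1 G) z 1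
    & hyp_op a b c G z = 0] by near: z.
  have Wz : wronskian F G z = 0 by near: z.
  by have := is_derive_quotient dF dG Fz; rewrite Wz mul0r.
move=> /near0_cst h; near=> z.
have Fz : F z != 0 by near: z.
have hz : G z / F z = G 0 / F 0 by near: z.
by rewrite -[RHS](divfK Fz) hz F0 G0 divr1 mul1r.
Unshelve. all: by end_near. Qed.

End Uniqueness.

(** * Binomial series and the branches of powers at 0 *)

Section OneSub.
Variables (K : numFieldType) (f : K -> K) (x : K).
Hypothesis fc : {for x, continuous f}.

Lemma continuous_one_sub : {for x, continuous (fun z => 1 - f z)}.
Proof. by apply: continuousB => //; exact: cst_continuous. Qed.

Lemma continuous_comp_one_sub (B : K -> K) : {for 1 - f x, continuous B} ->
  {for x, continuous (fun z => B (1 - f z))}.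
Proof.
move=> Bc; apply: (@continuous_comp _ _ _ (fun z => 1 - f z) B) => //.
exact: continuous_one_sub.
Qed.

Lemma near_one_sub (P : K -> Prop) : f x = 1 -> (\forall z \near (0 : K), P z) ->
  \forall z \near x, P (1 - f z).
Proof. by move=> fx1 P0; apply: continuous_one_sub; rewrite fx1 subrr. Qed.

End OneSub.

Section BinomialSeries.
Variable K : numFieldType.
Hypothesis geo_cvg : forall (v : nat -> K) (A : K), 0 <= A ->
  (forall n, `|v n| <= A * 2^-1 ^+ n) -> cvgn (series v).

Lemma psum0 (u : nat -> K) : psum u 0 = u 0.
Proof.
apply: pcvg_psum; rewrite /pcvg; apply: cvg_near_cst; near=> n.
have n0 : (0 < n)%N by near: n; exists 1%N.
rewrite /series /= -(prednK n0) big_nat_recl // expr0 mulr1 big1 ?addr0 // => i _.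
by rewrite exprS mul0r mulr0.
Unshelve. all: by end_near. Qed.

Lemma near_binomial_ode (a : K) (u : nat -> K) : geo_bounded u ->
  (forall n, n.+1%:R * u n.+1 = (a + n%:R) * u n) ->
  \forall z \near (0 : K), (1 - z) * psum (pdiff u) z = a * psum u z.
Proof.
move=> ub urec; have near_p0 := near_pcvg geo_cvg ub.
have near_p1 := near_pcvg geo_cvg (geo_bounded_pdiff ub).
near=> z.
have p0 : pcvg u z (psum u z) by near: z.
have p1 : pcvg (pdiff u) z (psum (pdiff u) z) by near: z.
have := pcvgD p1 (pcvgZ (-1) (pcvg_euler p1)).
rewrite (_ : (fun n => _) = (fun n => a * u n)) => [e|].
  by rewrite -(pcvg_unique e (pcvgZ a p0)); ring.
by apply/funext => n; rewrite /pdiff urec; ring.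
Unshelve. all: by end_near. Qed.

(** Recognises a branch of (1 - z)^(-a), for a = (p + 1) / (q + 1), from the equation (1 - z) B' = a
    B alone: the product below is then locally constant. *)
Lemma is_derive_binomial_invariant (B : K -> K) (a b z : K) (p q : nat) :
  a * q.+1%:R = p.+1%:R -> is_derive z 1 B b -> (1 - z) * b = a * B z ->
  is_derive z 1 (fun w => B w ^+ q.+1 * (1 - w) ^+ p.+1) 0.
Proof.
move=> apq dB e.
have := is_derive_mul (is_derive_exp q.+1 dB)
  (is_derive_exp p.+1 (is_derive_sub (is_derive_const 1 z) (is_derive_var z))).
congr is_derive; rewrite -apq /= !exprS.
transitivity (q.+1%:R * B z ^+ q * (1 - z) ^+ p * ((1 - z) * b - a * B z)).
  by ring.
by rewrite e subrr mulr0.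
Qed.

End BinomialSeries.

Section PowerAtZero.
Variable R : realType.
Local Notation C := (cplx R).

Lemma pochhammerS (a : C) n : pochhammer a n.+1 = pochhammer a n * (a + n%:R).
Proof. by rewrite /pochhammer big_ord_recr. Qed.

Lemma pochhammer0 (a : C) : pochhammer a 0 = 1.
Proof. by rewrite /pochhammer big_ord0. Qed.

Definition hyp_coef (a b c : C) (n : nat) : C :=
  pochhammer a n * pochhammer b n / (pochhammer c n * n`!%:R).

Lemma hyp2F1E (a b c : C) : hyp2F1 a b c = psum (hyp_coef a b c).
Proof. by []. Qed.

Lemma hyp_coef_rec (a b c : C) : 0 < c -> hyp_rec a b c (hyp_coef a b c).
Proof.
move=> c0 n; rewrite /hyp_coef !pochhammerS factS natrM.
have cn0 m : c + m%:R != 0 by rewrite gt_eqF // ltr_wpDr.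
have pc0 : pochhammer c n != 0.
  by elim: n => [|n ih]; rewrite ?pochhammer0 ?oner_neq0 // pochhammerS mulf_neq0.
have n0 : n.+1%:R != 0 :> C by rewrite pnatr_eq0.
have f0 : n`!%:R != 0 :> C by rewrite pnatr_eq0 -lt0n fact_gt0.
move: (pochhammer a n) (pochhammer b n) (pochhammer c n) pc0 (n`!%:R) f0 (cn0 n).
move: (c + _) (a + _) (b + _) (n.+1%:R) n0.
move=> cn an bn N N0 pa pb pc pc0 F F0 cn0'.
have -> : pa * an * (pb * bn) / (pc * cn * (N * F)) =
   (pa * pb * (an * bn) / (pc * F)) / (N * cn).
  by rewrite -[RHS]mulrA -invfM; congr (_ / _); [rewrite mulrACA|rewrite mulrACA [cn * _]mulrC mulrACA mulrC mulrACA].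
by rewrite mulrC divfK ?mulf_neq0 // mulrAC mulrC.
Qed.

Lemma hyp_coef0 (a b c : C) : hyp_coef a b c 0 = 1.
Proof. by rewrite /hyp_coef !pochhammer0 fact0 !mulr1 divr1. Qed.

Lemma hyp2F1_0 (a b c : C) : hyp2F1 a b c 0 = 1.
Proof. by rewrite hyp2F1E psum0 hyp_coef0. Qed.

Lemma hyp2F1_solution (a b c : C) : 0 <= a -> a <= c -> 0 <= b -> b <= 1 ->
  0 < c -> near_hyp_solution a b c (hyp2F1 a b c).
Proof.
move=> a0 ac b0 b1 c0; rewrite hyp2F1E.
have urec := hyp_coef_rec a b c0.
apply: (near_hyp_op_psum (@complex_geo_cvg R) _ urec).
exact: (hyp_rec_bounded a0 ac b0 b1 c0 (hyp_coef0 _ _ _) urec).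
Qed.

(** The series of (1 - z)^(-a), with a = (p + 1) / (q + 1), is the hypergeometric one with
    parameters a, 1; 1. The condition p <= q gives a <= 1, as [hyp_rec_bounded] requires. *)
Lemma binomial_branch (p q : nat) : (p <= q)%N ->
  exists2 B : C -> C, B 0 = 1 & \forall z \near (0 : C),
    {for z, continuous B} /\ B z ^+ q.+1 * (1 - z) ^+ p.+1 = 1.
Proof.
move=> pq; pose a : C := p.+1%:R / q.+1%:R.
have a0 : 0 <= a by rewrite divr_ge0.
have a1 : a <= 1 by rewrite ler_pdivrMr // mul1r ler_nat.
pose u := hyp_coef a 1 1.
have urec := hyp_coef_rec a 1 ltr01.
have ub := hyp_rec_bounded a0 a1 ler01 (lexx 1) ltr01 (hyp_coef0 _ _ _) urec.
have urec1 n : n.+1%:R * u n.+1 = (a + n%:R) * u n.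
  have n0 : (1 + n%:R : C) != 0 by rewrite nat1r pnatr_eq0.
  apply: (mulIf n0); by rewrite [RHS]mulrAC -urec mulrAC.
have dB := near_is_derive_psum (@complex_geo_cvg R) ub.
have ode := near_binomial_ode (@complex_geo_cvg R) ub urec1.
exists (psum u); first by rewrite psum0 /u hyp_coef0.
have apq : a * q.+1%:R = p.+1%:R by rewrite divfK ?pnatr_eq0.
have : \forall z \near (0 : C),
    is_derive (z : C) 1 (fun w => psum u w ^+ q.+1 * (1 - w) ^+ p.+1) 0.
  near=> z.
  have dz : is_derive (z : C) 1 (psum u) (psum (pdiff u) z) by near: z; exact: dB.
  have ez : (1 - z) * psum (pdiff u) z = a * psum u z by near: z; exact: ode.
  exact (is_derive_binomial_invariant apq dz ez).
move=> /near0_cst h; near=> z; split.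
  have dz : is_derive (z : C) 1 (psum u) (psum (pdiff u) z) by near: z; exact: dB.
  exact (is_derive_continuous dz).
have -> : psum u z ^+ q.+1 * (1 - z) ^+ p.+1 =
    psum u 0 ^+ q.+1 * (1 - 0) ^+ p.+1 by near: z; exact: h.
by rewrite psum0 /u hyp_coef0 subr0 !expr1n mulr1.
Unshelve. all: by end_near. Qed.

(** [pow_at0] is a choice, so it has the expected properties as soon as some branch exists; the
    binomial series evaluated at 1 - f provides one. The exponents -1/16, -1/48 and -1/6 lie in the
    range allowed here. *)
Lemma pow_at0_branch (f : C -> C) (r : rat) : -1 <= r -> r < 0 -> f 0 = 1 ->
  (\forall z \near (0 : C), {for z, continuous f}) ->
  pow_at0 f r 0 = 1 /\
  exists2 U : set C, open_nbhs 0 U & power_branch U f r (pow_at0 f r).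
Proof.
move=> r1 r0 f0 fc; apply: (@getPex _ [set g | g 0 = 1 /\
    exists2 U : set C, open_nbhs 0 U & power_branch U f r g]).
have [q qE] : exists q, denq r = q.+1%:Z.
  by have := denq_gt0 r; case: (denq r) => // -[|n] // _; exists n.
have [p pE] : exists p, numq r = - p.+1%:Z.
  have : numq r < 0 by rewrite numq_lt0.
  by case: (numq r) => // n _; exists n; rewrite NegzE.
have pq : (p <= q)%N.
  move: r1; rewrite -[r]divq_num_den qE pE lerNl -mulNr -rmorphN opprK.
  by rewrite ler_pdivrMr ?ltr0z // mul1r ler_int lez_nat ltnS.
have [B B0 BE] := binomial_branch pq.
exists (fun z => B (1 - f z)); split; first by rewrite f0 subrr.
have : \forall z \near (0 : C), [/\ f z != 0, {for z, continuous (fun z => B (1 - f z))}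
    & B (1 - f z) ^ denq r = f z ^ numq r].
  have fz := nbhs_singleton fc.
  have f0n : \forall z \near (0 : C), f z != 0.
    by apply: (continuous_near_neq0 fz); rewrite f0 oner_neq0.
  have BE' : \forall z \near (0 : C), {for 1 - f z, continuous B} /\
     B (1 - f z) ^+ q.+1 * (1 - (1 - f z)) ^+ p.+1 = 1.
    exact (near_one_sub fz f0 BE).
  near=> z.
  have fzc : {for z, continuous f} by near: z.
  have [Bc Bz] : {for 1 - f z, continuous B} /\
     B (1 - f z) ^+ q.+1 * (1 - (1 - f z)) ^+ p.+1 = 1 by near: z.
  split; first by near: z.
  - exact (continuous_comp_one_sub fzc Bc).
  - rewrite qE pE -exprnN -exprnP.
    by apply: divr1_eq; rewrite invrK; rewrite subKr in Bz.
rewrite {1}/prop_near1 nbhsE => -[U oU UP]; exists U => // z Uz; exact: UP.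
Unshelve. all: by end_near. Qed.

End PowerAtZero.

(** * The covering in the coordinate w *)

Definition horner_simpl := (hornerD, hornerN, hornerZ, hornerXn, hornerX, hornerC, hornerMn).
Definition deriv_simpl := (derivD, derivN, derivZ, derivXn, derivX, derivC).

Section Cover.
Variable K : numFieldType.
Implicit Types v w x : K.

(** In the coordinate w, the zeros of [cubQ] are the triple poles, those of [quadE] the points x = 0
    and x = 1, and those of [quinS] the double points above 1. The suffixes 1 and 2 denote
    derivatives. *)
Definition cubQ w : K := 4 * w ^+ 3 - 15 * w ^+ 2 + 18 * w - 9.
Definition cubQ1 w : K := 12 * w ^+ 2 - 30 * w + 18.
Definition cubQ2 w : K := 24 * w - 30.
Definition quadE w : K := 9 * w ^+ 2 - 14 * w + 9.
Definition quadE1 w : K := 18 * w - 14.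
Definition quinS w : K :=
  w ^+ 5 - 15 * w ^+ 4 + 48 * w ^+ 3 - 72 * w ^+ 2 + 54 * w - 18.
Definition quinS1 w : K :=
  5 * w ^+ 4 - 60 * w ^+ 3 + 144 * w ^+ 2 - 144 * w + 54.

Lemma is_derive_cubQ w : is_derive w 1 cubQ (cubQ1 w).
Proof.
have := is_derive_horner (4 *: 'X^3 - 15 *: 'X^2 + 18 *: 'X - 9%:P) w.
congr is_derive; first by apply/funext => z; rewrite !horner_simpl /cubQ; ring.
by rewrite !deriv_simpl !horner_simpl /cubQ1 /=; ring.
Qed.

Lemma is_derive_cubQ1 w : is_derive w 1 cubQ1 (cubQ2 w).
Proof.
have := is_derive_horner (12 *: 'X^2 - 30 *: 'X + 18%:P) w.
congr is_derive; first by apply/funext => z; rewrite !horner_simpl /cubQ1; ring.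
by rewrite !deriv_simpl !horner_simpl /cubQ2 /=; ring.
Qed.

Lemma is_derive_quadE w : is_derive w 1 quadE (quadE1 w).
Proof.
have := is_derive_horner (9 *: 'X^2 - 14 *: 'X + 9%:P) w.
congr is_derive; first by apply/funext => z; rewrite !horner_simpl /quadE; ring.
by rewrite !deriv_simpl !horner_simpl /quadE1 /=; ring.
Qed.

Lemma is_derive_quinS w : is_derive w 1 quinS (quinS1 w).
Proof.
have := is_derive_horner ('X^5 - 15 *: 'X^4 + 48 *: 'X^3 - 72 *: 'X^2
  + 54 *: 'X - 18%:P) w.
congr is_derive; first by apply/funext => z; rewrite !horner_simpl /quinS; ring.
by rewrite !deriv_simpl !horner_simpl /quinS1 /=; ring.
Qed.

Definition phiw w : K := w ^+ 8 * quadE w / (4 * cubQ w ^+ 3).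
Definition phiw1 w : K := 9 * w ^+ 7 * quinS w / cubQ w ^+ 4.
Definition phiw2 w : K :=
  9 * ((7 * w ^+ 6 * quinS w + w ^+ 7 * quinS1 w) * cubQ w
       - 4 * w ^+ 7 * quinS w * cubQ1 w) / cubQ w ^+ 5.

Lemma is_derive_phiw w : cubQ w != 0 -> is_derive w 1 phiw (phiw1 w).
Proof.
move=> Q0; have D0 : 4 * cubQ w ^+ 3 != 0 by rewrite mulf_neq0 ?expf_neq0 ?pnatr_eq0.
have := @is_derive_div K _ (fun w => 4 * cubQ w ^+ 3) w _ _ D0
  (is_derive_mul (is_derive_exp 8 (is_derive_var w)) (is_derive_quadE w))
  (is_derive_mul (is_derive_const 4 w) (is_derive_exp 3 (is_derive_cubQ w))).
congr is_derive; rewrite /phiw1 /= /cubQ1 /quadE /quadE1 /quinS.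
(* Q is made an atom, so that the side condition of [field] is just Q != 0; its expression in w is
   passed as the equation e. *)
have e : cubQ w = 4 * w ^+ 3 - 15 * w ^+ 2 + 18 * w - 9 by [].
by move: (cubQ w) Q0 e => Q Q0 e; field: e.
Qed.

Lemma is_derive_phiw1 w : cubQ w != 0 -> is_derive w 1 phiw1 (phiw2 w).
Proof.
move=> Q0; have D0 : cubQ w ^+ 4 != 0 by rewrite expf_neq0.
have := @is_derive_div K _ (fun w => cubQ w ^+ 4) w _ _ D0
  (is_derive_mul (is_derive_mul (is_derive_const 9 w)
    (is_derive_exp 7 (is_derive_var w))) (is_derive_quinS w))
  (is_derive_exp 4 (is_derive_cubQ w)).
by congr is_derive; rewrite /phiw2 /=; field.
Qed.

Lemma one_sub_phiw w : cubQ w != 0 ->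
  1 - phiw w = - 9 * quinS w ^+ 2 / (4 * cubQ w ^+ 3).
Proof.
rewrite /phiw /quadE /quinS => Q0.
have e : cubQ w = 4 * w ^+ 3 - 15 * w ^+ 2 + 18 * w - 9 by [].
by move: (cubQ w) Q0 e => Q Q0 e; field: e.
Qed.

Variables (b : K) (hb : b ^+ 2 = -2).

Lemma b_neq0 : b != 0.
Proof.
apply: contra_eq_neq hb => ->; rewrite expr0n eq_sym oppr_eq0.
by rewrite pnatr_eq0.
Qed.

(** 9 w is the linear factor of the numerator of [phi4]. Since (7 - 4 b)(7 + 4 b) = 81, dividing by
    9 gives w(0) w(1) = 1, which makes [quadE] self-reciprocal; it can then serve in the coordinate
    1 / w too. *)
Definition wcoord x : K := (8 * b * x + 7 - 4 * b) / 9.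

Lemma is_derive_wcoord x : is_derive x 1 wcoord (8 * b / 9).
Proof.
have := is_derive_mul (is_derive_sub (is_derive_add (is_derive_mul
  (is_derive_const (8 * b) x) (is_derive_var x)) (is_derive_const 7 x))
  (is_derive_const (4 * b) x)) (is_derive_const 9^-1 x).
by congr is_derive; ring.
Qed.

(** Eliminates x in favour of w; 1 / b = - b / 2 keeps the expression polynomial in b. *)
Lemma wcoordK x : x = - b * (9 * wcoord x - 7 + 4 * b) / 16.
Proof. by rewrite /wcoord; field: hb. Qed.

Definition phix x : K := phiw (wcoord x).
Definition phix1 x : K := phiw1 (wcoord x) * (8 * b / 9).
Definition phix2 x : K := phiw2 (wcoord x) * (8 * b / 9) * (8 * b / 9).
(** The logarithmic derivative of Q^(-1/16). At a triple pole the exponents 1/48 and 17/48 pull back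
    to 1/16 and 17/16, which this factor moves to 0 and 1. *)
Definition ldQ x : K := - 16^-1 * (cubQ1 (wcoord x) * (8 * b / 9) / cubQ (wcoord x)).
Definition ldQ1 x : K := - 16^-1 * (8 * b / 9) ^+ 2
  * ((cubQ2 (wcoord x) * cubQ (wcoord x) - cubQ1 (wcoord x) ^+ 2)
     / cubQ (wcoord x) ^+ 2).

Lemma near_cubQ_neq0 x : cubQ (wcoord x) != 0 ->
  \forall z \near x, cubQ (wcoord z) != 0.
Proof.
move=> Q0.
exact (@is_derive_near_neq0 K (fun x => cubQ (wcoord x)) x _ (is_derive_chain (is_derive_cubQ (wcoord x))
  (is_derive_wcoord x)) Q0).
Qed.

Lemma is_derive_phix x : cubQ (wcoord x) != 0 -> is_derive x 1 phix (phix1 x).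
Proof.
by move=> Q0; exact (is_derive_chain (is_derive_phiw Q0) (is_derive_wcoord x)).
Qed.

Lemma is_derive_phix1 x : cubQ (wcoord x) != 0 -> is_derive x 1 phix1 (phix2 x).
Proof.
move=> Q0; have := is_derive_mul (is_derive_chain (is_derive_phiw1 Q0)
  (is_derive_wcoord x)) (is_derive_const (8 * b / 9) x).
by congr is_derive; rewrite mulr0 addr0.
Qed.

Lemma is_derive_ldQ x : cubQ (wcoord x) != 0 -> is_derive x 1 ldQ (ldQ1 x).
Proof.
move=> Q0; have dw := is_derive_wcoord x.
have := is_derive_mul (is_derive_const (- 16^-1) x)
  (@is_derive_div K _ (fun x => cubQ (wcoord x)) x _ _ Q0
  (is_derive_mul (is_derive_chain (is_derive_cubQ1 (wcoord x)) dw)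
     (is_derive_const (8 * b / 9) x))
  (is_derive_chain (is_derive_cubQ (wcoord x)) dw)).
by congr is_derive; rewrite /ldQ1; field.
Qed.

Definition kappa x : K := 16 * wcoord x ^+ 6 / cubQ (wcoord x) ^+ 2.

Section Identities.
Variable x : K.
Hypothesis Q0 : cubQ (wcoord x) != 0.

(** This and the next two identities are the hypotheses of [pullback_hyp_op], numbered by the order
    of the derivative of y. Once x is eliminated, they are rational identities in w modulo b^2 =
    -2. *)
Lemma cover_identity2 :
  x * (1 - x) * phix1 x ^+ 2 = kappa x * (phix x * (1 - phix x)).
Proof.
rewrite /phix (one_sub_phiw Q0) /phix1 /kappa /phiw /phiw1.
move: (wcoordK x) Q0; move: (wcoord x) => w -> Qw.
(* Q and S match on both sides as atoms; only E is expanded, to be compared with x (1 - x). *)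
rewrite /quadE; move: (cubQ w) (quinS w) Qw => Q s Qw.
by field: hb.
Qed.

Lemma cover_identity1 :
  x * (1 - x) * (2 * ldQ x * phix1 x + phix2 x)
    + (7 / 8 - (5 / 24 + 13 / 24 + 1) * x) * phix1 x =
  kappa x * (7 / 8 - (1 / 48 + 17 / 48 + 1) * phix x).
Proof.
rewrite /phix /phix1 /phix2 /kappa /phiw /phiw1 /phiw2 /ldQ.
move: (wcoordK x) Q0; move: (wcoord x) => w -> Qw.
rewrite /quadE /quinS /quinS1 /cubQ1.
have e : cubQ w = 4 * w ^+ 3 - 15 * w ^+ 2 + 18 * w - 9 by [].
by move: (cubQ w) Qw e => Q Qw e; field: hb e.
Qed.

Lemma cover_identity0 :
  x * (1 - x) * (ldQ x ^+ 2 + ldQ1 x)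
    + (7 / 8 - (5 / 24 + 13 / 24 + 1) * x) * ldQ x - 5 / 24 * (13 / 24) =
  - kappa x * (1 / 48 * (17 / 48)).
Proof.
rewrite /kappa /ldQ /ldQ1.
move: (wcoordK x) Q0; move: (wcoord x) => w -> Qw.
rewrite /cubQ1 /cubQ2.
have e : cubQ w = 4 * w ^+ 3 - 15 * w ^+ 2 + 18 * w - 9 by [].
by move: (cubQ w) Qw e => Q Qw e; field: hb e.
Qed.

End Identities.

End Cover.

(** * The covering near infinity, in the coordinate v *)

Section CoverAtInfinity.
Variable K : numFieldType.
Implicit Types v w x : K.

(** [revQ] and [revS] are the reciprocal polynomials v^3 Q(1 / v) and v^5 S(1 / v). *)
Definition revQ v : K := 4 - 15 * v + 18 * v ^+ 2 - 9 * v ^+ 3.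
Definition revQ1 v : K := - 15 + 36 * v - 27 * v ^+ 2.
Definition revS v : K :=
  1 - 15 * v + 48 * v ^+ 2 - 72 * v ^+ 3 + 54 * v ^+ 4 - 18 * v ^+ 5.
Definition revS1 v : K :=
  - 15 + 96 * v - 216 * v ^+ 2 + 216 * v ^+ 3 - 90 * v ^+ 4.

Lemma is_derive_revQ v : is_derive v 1 revQ (revQ1 v).
Proof.
have := is_derive_horner (4%:P - 15 *: 'X + 18 *: 'X^2 - 9 *: 'X^3) v.
congr is_derive; first by apply/funext => z; rewrite !horner_simpl /revQ; ring.
by rewrite !deriv_simpl !horner_simpl /revQ1 /=; ring.
Qed.

Lemma is_derive_revS v : is_derive v 1 revS (revS1 v).
Proof.
have := is_derive_horner (1%:P - 15 *: 'X + 48 *: 'X^2 - 72 *: 'X^3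
  + 54 *: 'X^4 - 18 *: 'X^5) v.
congr is_derive; first by apply/funext => z; rewrite !horner_simpl /revS; ring.
by rewrite !deriv_simpl !horner_simpl /revS1 /=; ring.
Qed.

Definition psiv v : K := 4 * v * revQ v ^+ 3 / quadE v.
Definition psiv1 v : K := 144 * revQ v ^+ 2 * revS v / quadE v ^+ 2.
Definition psiv2 v : K :=
  144 * ((2 * revQ v * revQ1 v * revS v + revQ v ^+ 2 * revS1 v) * quadE v
         - 2 * revQ v ^+ 2 * revS v * quadE1 v) / quadE v ^+ 3.

Lemma is_derive_psiv v : quadE v != 0 -> is_derive v 1 psiv (psiv1 v).
Proof.
move=> E0.
have := is_derive_div E0 (is_derive_mul (is_derive_mul (is_derive_const 4 v)
  (is_derive_var v)) (is_derive_exp 3 (is_derive_revQ v))) (is_derive_quadE v).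
congr is_derive; rewrite /psiv1 /= /revQ1 /quadE1 /revS /revQ.
have e : quadE v = 9 * v ^+ 2 - 14 * v + 9 by [].
by move: (quadE v) E0 e => E E0 e; field: e.
Qed.

Lemma is_derive_psiv1 v : quadE v != 0 -> is_derive v 1 psiv1 (psiv2 v).
Proof.
move=> E0; have D0 : quadE v ^+ 2 != 0 by rewrite expf_neq0.
have := @is_derive_div K _ (fun v => quadE v ^+ 2) v _ _ D0
  (is_derive_mul (is_derive_mul (is_derive_const 144 v)
    (is_derive_exp 2 (is_derive_revQ v))) (is_derive_revS v))
  (is_derive_exp 2 (is_derive_quadE v)).
by congr is_derive; rewrite /psiv2 /=; field.
Qed.

Lemma one_sub_psiv v : quadE v != 0 -> 1 - psiv v = 9 * revS v ^+ 2 / quadE v.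
Proof.
rewrite /psiv /revQ /revS => E0.
have e : quadE v = 9 * v ^+ 2 - 14 * v + 9 by [].
by move: (quadE v) E0 e => E E0 e; field: e.
Qed.

Lemma phiw_inv v : v != 0 -> quadE v != 0 -> revQ v != 0 ->
  (phiw v^-1)^-1 = psiv v.
Proof.
move=> v0 E0 Q0; rewrite /phiw /psiv.
have -> : cubQ v^-1 = revQ v / v ^+ 3 by rewrite /cubQ /revQ; field.
have -> : quadE v^-1 = quadE v / v ^+ 2 by rewrite /quadE; field.
by move: (quadE v) (revQ v) E0 Q0 => E Q E0 Q0; field; rewrite v0 E0 Q0.
Qed.

Variables (b : K) (hb : b ^+ 2 = -2).
Let b0 := b_neq0 hb.

(** [lam] is 9 x w(1 / x), and [rho] is the denominator of the inverse Moebius map x = 8 b v /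
    rho(v). Through [rho], the derivative dv/dx = rho^2 / (72 b) is a function of v as well. *)
Definition lam x : K := 8 * b + (7 - 4 * b) * x.
Definition vcoord x : K := 9 * x / lam x.
Definition rho v : K := 9 - (7 - 4 * b) * v.

Lemma rho_vcoord x : lam x != 0 -> rho (vcoord x) = 72 * b / lam x.
Proof. by rewrite /rho /vcoord /lam => l0; field. Qed.

Lemma is_derive_lam x : is_derive x 1 lam (7 - 4 * b).
Proof.
have := is_derive_add (is_derive_const (8 * b) x)
  (is_derive_mul (is_derive_const (7 - 4 * b) x) (is_derive_var x)).
by congr is_derive; ring.
Qed.

Lemma is_derive_vcoord x : lam x != 0 ->
  is_derive x 1 vcoord (rho (vcoord x) ^+ 2 / (72 * b)).
Proof.
move=> l0; have := is_derive_div l0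
  (is_derive_mul (is_derive_const 9 x) (is_derive_var x)) (is_derive_lam x).
by congr is_derive; rewrite rho_vcoord //; move: l0; rewrite /lam => l0; field; rewrite b0 l0.
Qed.

Lemma is_derive_rho v : is_derive v 1 rho (- (7 - 4 * b)).
Proof.
have := is_derive_sub (is_derive_const 9 v)
  (is_derive_mul (is_derive_const (7 - 4 * b) v) (is_derive_var v)).
by congr is_derive; ring.
Qed.

Lemma quadE_vcoord x : lam x != 0 -> quadE (vcoord x) = - 1152 * (1 - x) / lam x ^+ 2.
Proof. by rewrite /quadE /vcoord /lam => l0; field: hb. Qed.

Definition psix x : K := psiv (vcoord x).
Definition psix1 x : K := psiv1 (vcoord x) * (rho (vcoord x) ^+ 2 / (72 * b)).
Definition psix2 x : K :=
  (psiv2 (vcoord x) * (rho (vcoord x) ^+ 2 / (72 * b))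
   + psiv1 (vcoord x) * (2 * rho (vcoord x) * - (7 - 4 * b) / (72 * b)))
  * (rho (vcoord x) ^+ 2 / (72 * b)).
(** The logarithmic derivative of (1 - x)^(-1/48) lam^(-1/6). The function [psix] has a simple pole
    at x = 1 and a pole of order 8 at the zero of [lam]; the exponent 1/48 at oo thus pulls back to
    1/48 and 8/48, which theta cancels. *)
Definition ldT x : K := 48^-1 / (1 - x) - 6^-1 * (7 - 4 * b) / lam x.
Definition ldT1 x : K := 48^-1 / (1 - x) ^+ 2 + 6^-1 * (7 - 4 * b) ^+ 2 / lam x ^+ 2.

(** Puts 1 - x != 0 in the shape of the side condition that [field] meets once x is eliminated. *)
Lemma one_sub_vcoordK v x : rho v != 0 -> x = 8 * b * v / rho v -> 1 - x != 0 ->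
  rho v - 8 * b * v != 0.
Proof.
move=> r0 ->; rewrite -{1}(divff r0) -mulrBl.
by apply: contra_neq => ->; rewrite mul0r.
Qed.

Section Local.
Variable x : K.
Hypotheses (l0 : lam x != 0) (x1 : 1 - x != 0).

Lemma quadE_vcoord_neq0 : quadE (vcoord x) != 0.
Proof.
by rewrite quadE_vcoord // !mulf_neq0 ?invr_eq0 ?expf_neq0 // oppr_eq0 pnatr_eq0.
Qed.
Let E0 := quadE_vcoord_neq0.

Lemma is_derive_psix : is_derive x 1 psix (psix1 x).
Proof. exact (is_derive_chain (is_derive_psiv E0) (is_derive_vcoord l0)). Qed.

Lemma is_derive_psix1 : is_derive x 1 psix1 (psix2 x).
Proof.
have dv := is_derive_vcoord l0.
have := is_derive_mul (is_derive_chain (is_derive_psiv1 E0) dv)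
  (is_derive_mul (is_derive_exp 2 (is_derive_chain (is_derive_rho (vcoord x)) dv))
    (is_derive_const (72 * b)^-1 x)).
congr is_derive; rewrite /psix2.
move: (psiv2 _) (psiv1 _) (rho _) => p2 p1 r /=.
by field.
Qed.

Lemma is_derive_ldT : is_derive x 1 ldT (ldT1 x).
Proof.
have := is_derive_sub (is_derive_mul (is_derive_const 48^-1 x)
    (@is_derive_inv K (fun x => 1 - x) x _ x1 (is_derive_sub (is_derive_const 1 x) (is_derive_var x))))
  (is_derive_mul (is_derive_const (6^-1 * (7 - 4 * b)) x)
    (is_derive_inv l0 (is_derive_lam x))).
congr is_derive; rewrite /ldT1; move: (lam x) l0 => l l0'.
by field; rewrite l0' x1.
Qed.

Definition kappa2 : K := 72 * revQ (vcoord x) / (b * ((1 - x) * rho (vcoord x))).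

Lemma rho_neq0 : rho (vcoord x) != 0.
Proof. by rewrite rho_vcoord // !mulf_neq0 ?invr_eq0 ?pnatr_eq0. Qed.

Lemma vcoordK : x = 8 * b * vcoord x / rho (vcoord x).
Proof.
rewrite rho_vcoord // /vcoord; move: (lam x) l0 => l l0'.
by field; rewrite b0 l0'.
Qed.

Lemma lam_vcoord : lam x = 72 * b / rho (vcoord x).
Proof. by rewrite rho_vcoord // invf_div mulrCA divff ?mulr1 // mulf_neq0 ?pnatr_eq0. Qed.

Lemma cover_inf_identity2 :
  x * (1 - x) * psix1 x ^+ 2 = kappa2 * (psix x * (1 - psix x)).
Proof.
rewrite /psix (one_sub_psiv E0) /psix1 /kappa2 /psiv /psiv1.
move: x1 E0 rho_neq0 vcoordK; move: (vcoord x) => v x1' E0' r0 xE.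
have s0 := one_sub_vcoordK r0 xE x1'.
rewrite {x1'}xE; move: s0 r0; rewrite /rho => s0 r0.
have e : quadE v = 9 * v ^+ 2 - 14 * v + 9 by [].
move: (quadE v) (revQ v) (revS v) E0' e => E q s E0' e.
by field: hb e; rewrite ?b0 ?r0 ?s0 ?E0'.
Qed.

Lemma cover_inf_identity1 :
  x * (1 - x) * (2 * ldT x * psix1 x + psix2 x)
    + (2 / 3 - (5 / 24 + 1 / 3 + 1) * x) * psix1 x =
  kappa2 * (2 / 3 - (1 / 48 + 7 / 48 + 1) * psix x).
Proof.
rewrite /psix /psix1 /psix2 /kappa2 /psiv /psiv1 /psiv2 /ldT lam_vcoord.
move: x1 E0 rho_neq0 vcoordK; move: (vcoord x) => v x1' E0' r0 xE.
have s0 := one_sub_vcoordK r0 xE x1'.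
rewrite {x1'}xE; move: s0 r0; rewrite /rho => s0 r0.
have e : quadE v = 9 * v ^+ 2 - 14 * v + 9 by [].
rewrite /quadE1 /revQ1 /revQ /revS /revS1.
move: (quadE v) E0' e => E E0' e.
by field: hb e; rewrite ?b0 ?r0 ?s0 ?E0'.
Qed.

Lemma cover_inf_identity0 :
  x * (1 - x) * (ldT x ^+ 2 + ldT1 x)
    + (2 / 3 - (5 / 24 + 1 / 3 + 1) * x) * ldT x - 5 / 24 * (1 / 3) =
  - kappa2 * (1 / 48 * (7 / 48)).
Proof.
rewrite /kappa2 /ldT /ldT1 lam_vcoord.
move: x1 rho_neq0 vcoordK; move: (vcoord x) => v x1' r0 xE.
have s0 := one_sub_vcoordK r0 xE x1'.
rewrite {x1'}xE; move: s0 r0; rewrite /rho /revQ => s0 r0.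
by field: hb; rewrite ?b0 ?r0 ?s0.
Qed.

End Local.

End CoverAtInfinity.

(** * Coverings of the projective line *)

Section Covering.
Variable K : closedFieldType.

Lemma mup_prod_XsubC (r : seq K) (x : K) :
  mup x (\prod_(z <- r) ('X - z%:P)) = count_mem x r.
Proof.
elim: r => [|z r ih]; first by rewrite big_nil mupNroot // root1.
rewrite big_cons mupM ?polyXsubC_eq0 ?monic_neq0 ?monic_prod_XsubC // ih /=.
by rewrite -['X - z%:P]expr1 mup_XsubCX; case: eqP.
Qed.

Lemma sum_count_undup (T : eqType) (r : seq T) :
  (\sum_(x <- undup r) count_mem x r)%N = size r.
Proof.
rewrite -(perm_size (perm_count_undup r)) size_flatten /shape -map_comp sumnE big_map.
by apply: eq_bigr => x _; rewrite /= size_nseq.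
Qed.

(** The fibre polynomial h has degree at most d and splits: its roots count deg h with multiplicity,
    and oo belongs to the fibre exactly when the degree drops, with multiplicity d - deg h. *)
Lemma is_covering_coprime (f : ratfun K) : coprimep (num f) (den f) ->
  (0 < rat_deg f)%N -> is_covering f (rat_deg f).
Proof.
move=> cop d0; split=> // Q; set h := fibre_poly f Q; set d := rat_deg f.
have szN : (size (num f) <= d.+1)%N by rewrite /d /rat_deg; lia.
have szD : (size (den f) <= d.+1)%N by rewrite /d /rat_deg; lia.
have top : (size (num f) == d.+1) || (size (den f) == d.+1).
  by move: d0; rewrite /d /rat_deg; lia.
(* If h vanished, coprimality would make numerator and denominator constant, against d > 0. *)
have h0 : h != 0.
  rewrite /h /fibre_poly; case: (Q) => [c|].
    apply/eqP => /subr0_eq e; move: cop; rewrite e coprimep_sym => cop'.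
    have : size (den f) == 1%N.
      case: (eqVneq c 0) cop' => [->|c0].
        by rewrite scale0r coprimep0 size_poly_eq1.
      by rewrite coprimepZr // coprimepp.
    move/eqP => sD; have := size_scale_leq c (den f); rewrite -e sD => sN.
    by move: d0; rewrite /rat_deg sD; lia.
  apply/eqP => e; move: cop; rewrite e coprimep0 -size_poly_eq1 => /eqP sN.
  by move: d0; rewrite /rat_deg e size_poly0 sN.
have szh : (size h <= d.+1)%N.
  rewrite /h /fibre_poly; case: (Q) => [c|] //.
  apply: leq_trans (size_polyD _ _) _; rewrite size_polyN geq_max szN /=.
  exact: leq_trans (size_scale_leq _ _) szD.
have finE x : (rat_map f (Some x) == Q) = root h x.
  rewrite /rat_map /P1_point /h /fibre_poly; case: (Q) => [c|]; last first.
    by rewrite rootE; case: (_.[_] == 0).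
  rewrite rootE !hornerE subr_eq0; case: (eqVneq (den f).[x] 0) => [dx0|dx0].
    rewrite dx0 mulr0; symmetry; apply/negbTE; apply: contraL cop => nx0.
    apply/negP => cop; have := coprimep_root cop nx0.
    by rewrite dx0 eqxx.
  by rewrite (inj_eq Some_inj) -[RHS](inj_eq (mulIf (invr_neq0 dx0))) mulfK.
have infE : (rat_map f None == Q) = (size h <= d)%N.
  have hd : (size h <= d)%N = (h`_d == 0).
    apply/idP/eqP => [/leq_sizeP/(_ d (leqnn d)) //|hd0].
    rewrite leqNgt; apply/negP => sh.
    have sE : size h = d.+1 by apply/eqP; rewrite eqn_leq szh.
    by move: h0; rewrite -lead_coef_eq0 /lead_coef sE /= hd0 eqxx.
  have topE (p : {poly K}) : (size p == d.+1) -> p`_d != 0.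
    move=> sp; have : p != 0 by rewrite -size_poly_gt0 (eqP sp).
    by rewrite -lead_coef_eq0 /lead_coef (eqP sp).
  rewrite hd /rat_map -/d /P1_point /h /fibre_poly; case: (Q) => [c|]; last by case: (_ == 0).
  rewrite coefB coefZ subr_eq0; case: (eqVneq (den f)`_d 0) => [dd0|dd0].
    rewrite dd0 mulr0; symmetry; apply/negbTE.
    by case/orP: top => /topE //; rewrite dd0 eqxx.
  by rewrite (inj_eq Some_inj) -[RHS](inj_eq (mulIf (invr_neq0 dd0))) mulfK.
have [r hE] := closed_field_poly_normal h.
have lc0 : lead_coef h != 0 by rewrite lead_coef_eq0.
have szr : size h = (size r).+1 by rewrite hE size_scale // size_prod_XsubC.
have rootr x : root h x = (x \in r) by rewrite hE rootZ // root_prod_XsubC.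
have muph x : mup x h = count_mem x r.
  rewrite hE -mul_polyC mupMr ?mup_prod_XsubC //.
  by rewrite rootC.
exists ((if (size h <= d)%N then [:: None] else [::]) ++ map Some (undup r)); split.
- have us : uniq (map Some (undup r)) by rewrite map_inj_uniq ?undup_uniq //; exact: Some_inj.
  by case: ifP => //= _; rewrite us andbT; apply/negP => /mapP[].
- case=> [x|]; rewrite mem_cat.
    rewrite finE rootr mem_map ?mem_undup; last exact: Some_inj.
    by case: ifP.
  rewrite infE; have -> : (None \in [seq Some i | i <- undup r]) = false.
    by apply/negP => /mapP[].
  by rewrite orbF; case: ifP.
- rewrite big_cat big_map /=.
  have -> : (\sum_(x <- undup r) ram_index f (Some x))%N = size r.
    rewrite -sum_count_undup; apply: eq_big_seq => x; rewrite mem_undup -rootr -finE.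
    by move=> /eqP e; rewrite /ram_index e -/h muph.
  case: ifP => [sh|/negbT sh].
    rewrite big_seq1 /ram_index; move: sh; rewrite -infE => /eqP -> .
    by rewrite -/h szr /= subnK // -ltnS -szr.
  by rewrite big_nil add0n; move: sh; rewrite -ltnNge szr ltnS => sh; apply/eqP; rewrite eqn_leq sh -ltnS -szr szh.
Qed.

End Covering.

(** * The covering phi4 *)

Section Phi4.
Variable K : numFieldType.
Variables (b : K) (hb : b ^+ 2 = -2).

(** The polynomials of [phi4] over any [numFieldType]: over [cplx R], [phi4_den] is [cub4 ^+ 3] and
    [phi4_num] is [num4]. *)
Definition cub4 : {poly K} := (2048 * b) *: 'X^3 - (3072 * b) *: 'X^2
  - 3264 *: 'X^2 + (912 * b) *: 'X + 3264 *: 'X + (56 * b - 17)%:P.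
Definition num4 : {poly K} :=
  4 *: 'X * ('X - 1) * ((8 * b) *: 'X + (7 - 4 * b)%:P) ^+ 8.

Lemma cub4E x : cub4.[x] = - (729 / 2) * cubQ (wcoord b x).
Proof. by rewrite !horner_simpl /cubQ /wcoord; field: hb. Qed.

Lemma num4E x : num4.[x] = 4 * x * (x - 1) * (9 * wcoord b x) ^+ 8.
Proof.
rewrite /num4 hornerM horner_exp hornerM !horner_simpl /wcoord.
by congr (_ * _ ^+ 8); field.
Qed.

Lemma cub4_neq0 x : (cub4.[x] != 0) = (cubQ (wcoord b x) != 0).
Proof. by rewrite cub4E mulf_eq0 oppr_eq0 mulf_eq0 invr_eq0 !pnatr_eq0. Qed.

Lemma x1x_wcoord x : x * (x - 1) = - (9 / 128) * quadE (wcoord b x).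
Proof. by rewrite /quadE /wcoord; field: hb. Qed.

Lemma phixE x : num4.[x] / cub4.[x] ^+ 3 = phix b x.
Proof.
rewrite num4E cub4E -[4 * x * _]mulrA x1x_wcoord /phix /phiw.
(* At a pole both sides are 0, by the convention 0^-1 = 0; the equality is therefore one of
   functions. *)
move: (wcoord b x) => w; case: (eqVneq (cubQ w) 0) => [->|Q0].
  by rewrite mulr0 expr0n !mulr0 !invr0 !mulr0.
by move: (quadE w) (cubQ w) Q0 => E Q Q0; field.
Qed.

Lemma cubQ_quadE_coprime (w : K) : w * quadE w = 0 -> cubQ w != 0.
Proof.
move=> /eqP; rewrite mulf_eq0 => /orP[/eqP ->|/eqP E0].
  rewrite /cubQ !expr0n !mulr0 subrr addr0 sub0r oppr_eq0.
  by rewrite pnatr_eq0.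
(* Euclid's algorithm: 81 Q = (36 w - 79) E + (28 w - 18), and E = (28 w - 18)(9/28 w - 115/392) +
   729/196. *)
apply/eqP => Q0; suff : (729 / 196 : K) = 0.
  by apply/eqP; rewrite mulf_neq0 ?invr_eq0 ?pnatr_eq0.
transitivity (quadE w - (81 * cubQ w - quadE w * (36 * w - 79))
    * (9 / 28 * w - 115 / 392)); last by rewrite E0 Q0; ring.
by rewrite /quadE /cubQ; field.
Qed.

Lemma num4_root_den x : root num4 x -> (cub4 ^+ 3).[x] != 0.
Proof.
rewrite rootE num4E -[4 * x * _]mulrA x1x_wcoord => /eqP e.
rewrite horner_exp expf_neq0 // cub4_neq0; apply: cubQ_quadE_coprime.
move: (wcoord b x) (quadE _) e => w E; case: (eqVneq w 0) => [->|w0] e.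
  by rewrite mul0r.
have -> : E = - (32 / 9) * (4 * (- (9 / 128) * E) * (9 * w) ^+ 8) / (9 * w) ^+ 8.
  by field.
by rewrite e !(mulr0, mul0r).
Qed.

Lemma size_num4 : size num4 = 11%N.
Proof.
have b0 := b_neq0 hb.
have b8 : 8 * b != 0 by rewrite mulf_neq0 ?pnatr_eq0.
have lin : (8 * b) *: 'X + (7 - 4 * b)%:P =
    (8 * b) *: ('X - (- ((7 - 4 * b) / (8 * b)))%:P) :> {poly K}.
  rewrite polyCN opprK scalerDr; congr (_ + _).
  by rewrite -mul_polyC -polyCM mulrCA divff ?mulr1.
rewrite /num4 lin exprZn -!scalerAl -scalerAr !size_scale ?expf_neq0 ?pnatr_eq0 //.
rewrite -[1](polyC1) size_mul ?mulf_neq0 ?polyX_eq0 ?expf_neq0 ?polyXsubC_eq0 //.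
by rewrite size_exp_XsubC mulrC size_mulX ?polyXsubC_eq0 // size_XsubC.
Qed.

Lemma size_den4 : (size (cub4 ^+ 3) <= 10)%N.
Proof.
apply: leq_trans (size_poly_exp_leq _ _) _.
suff : (size cub4 <= 4)%N by case: (size cub4) => [|n] //=; lia.
by apply/leq_sizeP => j hj; rewrite !coefE; do 4 (case: j hj => [//|j] hj);
  rewrite /= ?mulr0 ?addr0 ?subr0.
Qed.

End Phi4.

(** * Pulling back solutions near 0 *)

Lemma continuous_near (K : numFieldType) (f : K -> K) (x : K) (P : K -> Prop) :
  {for x, continuous f} -> (\forall z \near f x, P z) -> \forall z \near x, P (f z).
Proof. by move=> fc Px; exact: fc. Qed.

Section LocalPullback.
Variable K : numFieldType.
Variables (t phi L P L1 P1 kap y : K -> K) (a b c a' b' c' : K).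

(** Common to both identities, with phi = phi_4 and phi = 1 / phi_4(1 / x); phi(0) = 0 brings
    solutions near 0 to functions near 0. *)
Lemma local_pullback_solution :
  (\forall z \near (0 : K), [/\ is_derive (z : K) 1 t (L z * t z),
     is_derive (z : K) 1 phi (P z), is_derive (z : K) 1 L (L1 z)
     & is_derive (z : K) 1 P (P1 z)]) ->
  (\forall z \near (0 : K), [/\
    z * (1 - z) * P z ^+ 2 = kap z * (phi z * (1 - phi z)),
    z * (1 - z) * (2 * L z * P z + P1 z) + (c' - (a' + b' + 1) * z) * P z =
      kap z * (c - (a + b + 1) * phi z)
    & z * (1 - z) * (L z ^+ 2 + L1 z) + (c' - (a' + b' + 1) * z) * L z - a' * b' =
      - kap z * (a * b)]) ->
  phi 0 = 0 ->
  (\forall z \near (0 : K), [/\ derivable y z 1, derivable (derive1 y) z 1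
     & hyp_op a b c y z = 0]) ->
  let G z := t z * y (phi z) in
  \forall z \near (0 : K), [/\ derivable G z 1, derivable (derive1 G) z 1
     & hyp_op a' b' c' G z = 0].
Proof.
move=> nd nid phi0 ny G.
have phic : {for 0, continuous phi}.
  by have [_ /is_derive_continuous] := nbhs_singleton nd.
have nyphi : \forall z \near (0 : K), [/\ derivable y (phi z) 1,
    derivable (derive1 y) (phi z) 1 & hyp_op a b c y (phi z) = 0].
  apply: (@continuous_near _ phi 0 (fun w => [/\ derivable y w 1,
    derivable (derive1 y) w 1 & hyp_op a b c y w = 0]) phic).
  by rewrite phi0.
have nnd := near_join nd; have nnyphi := near_join nyphi.
near=> z.
have nd' : \forall z \near z, [/\ is_derive (z : K) 1 t (L z * t z),
     is_derive (z : K) 1 phi (P z), is_derive (z : K) 1 L (L1 z)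
     & is_derive (z : K) 1 P (P1 z)] by near: z.
have ny' : \forall z \near z, [/\ derivable y (phi z) 1,
    derivable (derive1 y) (phi z) 1 & hyp_op a b c y (phi z) = 0] by near: z.
have dt : \forall z \near z, is_derive (z : K) 1 t (L z * t z).
  by apply: filterS nd' => w [].
have dphi : \forall z \near z, is_derive (z : K) 1 phi (P z).
  by apply: filterS nd' => w [].
have dy : \forall z \near z, derivable y (phi z) 1 by apply: filterS ny' => w [].
have [_ _ dL dP] := nbhs_singleton nd'.
have [_ ddy hy] := nbhs_singleton ny'.
have [dG ddG] := pullback_twice_derivable dt dphi dL dP dy ddy.
split=> //.
have [e2 e1 e0] : [/\
    z * (1 - z) * P z ^+ 2 = kap z * (phi z * (1 - phi z)),
    z * (1 - z) * (2 * L z * P z + P1 z) + (c' - (a' + b' + 1) * z) * P z =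
      kap z * (c - (a + b + 1) * phi z)
    & z * (1 - z) * (L z ^+ 2 + L1 z) + (c' - (a' + b' + 1) * z) * L z - a' * b' =
      - kap z * (a * b)] by near: z.
by rewrite /G (pullback_hyp_op dt dphi dL dP dy ddy e2 e1 e0) hy mulr0.
Unshelve. all: by end_near. Qed.

End LocalPullback.

(** * The pull-backs by phi_4(x) and by 1 / phi_4(1 / x) *)

Section CoverPullback.
Variable K : numFieldType.
Variables (b : K) (hb : b ^+ 2 = -2).

Lemma cover_pullback (t y : K -> K) (x : K) : cubQ (wcoord b x) != 0 ->
  (\forall z \near x, is_derive (z : K) 1 t (ldQ b z * t z)) ->
  (\forall z \near x, derivable y (phix b z) 1) ->
  derivable (derive1 y) (phix b x) 1 ->
  let G z := t z * y (phix b z) in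
  [/\ derivable G x 1, derivable (derive1 G) x 1
    & hyp_op (5 / 24) (13 / 24) (7 / 8) G x =
      t x * kappa b x * hyp_op (1 / 48) (17 / 48) (7 / 8) y (phix b x)].
Proof.
move=> Q0 dt dy ddy G.
have dphi : \forall z \near x, is_derive (z : K) 1 (phix b) (phix1 b z).
  by apply: filterS (near_cubQ_neq0 Q0) => z; exact: is_derive_phix.
have dL := is_derive_ldQ Q0; have dP := is_derive_phix1 Q0.
have [dG ddG] := pullback_twice_derivable dt dphi dL dP dy ddy.
split; [exact dG|exact ddG|].
exact (pullback_hyp_op dt dphi dL dP dy ddy (cover_identity2 hb Q0)
  (cover_identity1 hb Q0) (cover_identity0 hb Q0)).
Qed.

Lemma kappa_neq0 (x : K) : wcoord b x != 0 -> cubQ (wcoord b x) != 0 ->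
  kappa b x != 0.
Proof.
move=> w0 Q0; apply: mulf_neq0; last by rewrite invr_eq0 expf_neq0.
by apply: mulf_neq0; rewrite ?pnatr_eq0 // expf_neq0.
Qed.

Lemma is_derive_scaled_cubQ (k x : K) :
  is_derive x 1 (fun z => k * cubQ (wcoord b z)) (k * (cubQ1 (wcoord b x) * (8 * b / 9))).
Proof.
have := is_derive_mul (is_derive_const k x)
  (is_derive_chain (is_derive_cubQ (wcoord b x)) (is_derive_wcoord b x)).
by congr is_derive; rewrite mul0r add0r.
Qed.

(** Constant factors leave a logarithmic derivative unchanged. This serves both for [cub4], where k
    = -729/2, and for the cubic of the statement, which is Q normalized to be 1 at x = 0. *)
Lemma scaled_ldQ (k x : K) : k != 0 ->
  ratr (- (1 / 16)) * (k * (cubQ1 (wcoord b x) * (8 * b / 9))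
    / (k * cubQ (wcoord b x))) = ldQ b x.
Proof.
move=> k0; rewrite /ldQ rmorphN fmorph_div rmorph1 rmorph_nat div1r.
by rewrite -mulf_div divff // mul1r.
Qed.

Lemma cubQ_wcoord0_neq0 : cubQ (wcoord b 0) != 0.
Proof.
apply: cubQ_quadE_coprime; have := x1x_wcoord hb 0; rewrite mul0r => /esym/eqP.
rewrite mulf_eq0 oppr_eq0 mulf_eq0 invr_eq0 !pnatr_eq0 /= => /eqP ->.
by rewrite mulr0.
Qed.

Lemma phix0 : phix b 0 = 0.
Proof.
have := x1x_wcoord hb 0; rewrite mul0r => /esym/eqP.
rewrite mulf_eq0 oppr_eq0 mulf_eq0 invr_eq0 !pnatr_eq0 /= => /eqP E0.
by rewrite /phix /phiw E0 mulr0 mul0r.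
Qed.

Lemma normalized_cubic (x : K) :
  1 + 16 * (4 - 17 * b) / 9 * x - 64 * (167 - 136 * b) / 243 * x ^+ 2
    + 2048 * (112 - 17 * b) / 6561 * x ^+ 3 =
  (cubQ (wcoord b 0))^-1 * cubQ (wcoord b x).
Proof.
apply: (mulfI cubQ_wcoord0_neq0); rewrite mulVKf ?cubQ_wcoord0_neq0 //.
by rewrite /cubQ /wcoord; field: hb.
Qed.

Lemma near_cover_solution (t y : K -> K) :
  (\forall z \near (0 : K), is_derive (z : K) 1 t (ldQ b z * t z)) ->
  (\forall z \near (0 : K), [/\ derivable y z 1, derivable (derive1 y) z 1
     & hyp_op (1 / 48) (17 / 48) (7 / 8) y z = 0]) ->
  let G z := t z * y (phix b z) in
  \forall z \near (0 : K), [/\ derivable G z 1, derivable (derive1 G) z 1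
     & hyp_op (5 / 24) (13 / 24) (7 / 8) G z = 0].
Proof.
move=> dt; have nQ := near_cubQ_neq0 cubQ_wcoord0_neq0.
apply: (@local_pullback_solution K t (phix b) (ldQ b) (phix1 b) (ldQ1 b) (phix2 b)
  (kappa b) y) phix0.
  apply: filterS (filterI dt nQ) => z [dtz Qz]; split; first exact dtz.
  - exact (is_derive_phix Qz).
  - exact (is_derive_ldQ Qz).
  - exact (is_derive_phix1 Qz).
apply: filterS nQ => z Qz; split.
- exact (cover_identity2 hb Qz).
- exact (cover_identity1 hb Qz).
- exact (cover_identity0 hb Qz).
Qed.

Let b0 := b_neq0 hb.

Lemma lam0_neq0 : lam b 0 != 0.
Proof. by rewrite /lam mulr0 addr0 mulf_neq0 ?pnatr_eq0. Qed.

Lemma near_lam_neq0 : \forall z \near (0 : K), lam b z != 0.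
Proof. exact (is_derive_near_neq0 (is_derive_lam b 0) lam0_neq0). Qed.

Lemma near_one_sub_neq0 : \forall z \near (0 : K), 1 - z != 0.
Proof.
apply: (is_derive_near_neq0 (is_derive_sub (is_derive_const 1 0) (is_derive_var 0))).
by rewrite subr0 oner_neq0.
Qed.

Lemma psix0 : psix b 0 = 0.
Proof. by rewrite /psix /psiv /vcoord mulr0 mul0r mulr0 mul0r mul0r. Qed.

Lemma near_psix : \forall z \near (0 : K), 1 / phix b (1 / z) = psix b z.
Proof.
have Q0 : revQ (vcoord b 0) != 0.
  by rewrite /vcoord mulr0 mul0r /revQ !expr0n !mulr0 !subr0 !addr0 pnatr_eq0.
have nQ := is_derive_near_neq0
  (is_derive_chain (is_derive_revQ (vcoord b 0)) (is_derive_vcoord hb lam0_neq0)) Q0.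
apply: filterS (filterI nQ (filterI near_lam_neq0 near_one_sub_neq0)) => z.
move=> [Qz [lz z1]]; rewrite !div1r.
(* At z = 0 the left side is 0 by the convention 0^-1 = 0, used twice around phi_4(0) = 0. *)
case: (eqVneq z 0) => [->|z0]; first by rewrite invr0 phix0 psix0 invr0.
have -> : phix b z^-1 = phiw (vcoord b z)^-1.
  by congr phiw; rewrite /vcoord /lam /wcoord invf_div; field.
have v0 : vcoord b z != 0 by rewrite /vcoord !mulf_neq0 ?invr_eq0 ?pnatr_eq0.
exact (phiw_inv v0 (quadE_vcoord_neq0 hb lz z1) Qz).
Qed.

Lemma near_cover_inf_solution (t y : K -> K) :
  (\forall z \near (0 : K), is_derive (z : K) 1 t (ldT b z * t z)) ->
  (\forall z \near (0 : K), [/\ derivable y z 1, derivable (derive1 y) z 1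
     & hyp_op (1 / 48) (7 / 48) (2 / 3) y z = 0]) ->
  let G z := t z * y (psix b z) in
  \forall z \near (0 : K), [/\ derivable G z 1, derivable (derive1 G) z 1
     & hyp_op (5 / 24) (1 / 3) (2 / 3) G z = 0].
Proof.
move=> dt; have nl := near_lam_neq0; have n1 := near_one_sub_neq0.
apply: (@local_pullback_solution K t (psix b) (ldT b) (psix1 b) (ldT1 b) (psix2 b)
  (kappa2 b) y) psix0; near=> z.
  have dtz : is_derive (z : K) 1 t (ldT b z * t z) by near: z.
  have lz : lam b z != 0 by near: z.
  have z1 : 1 - z != 0 by near: z.
  split; first exact dtz.
  - exact (is_derive_psix hb lz z1).
  - exact (is_derive_ldT lz z1).
  - exact (is_derive_psix1 hb lz z1).
have lz : lam b z != 0 by near: z.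
have z1 : 1 - z != 0 by near: z.
split.
- exact (cover_inf_identity2 hb lz z1).
- exact (cover_inf_identity1 hb lz z1).
- exact (cover_inf_identity0 hb lz z1).
Unshelve. all: by end_near. Qed.

Lemma normalized_lam (x : K) : 1 - (8 + 7 * b) / 16 * x = (8 * b)^-1 * lam b x.
Proof. by rewrite /lam; field: hb. Qed.

Lemma is_derive_theta_inf (g1 g2 : K -> K) (x : K) : lam b x != 0 -> 1 - x != 0 ->
  is_derive x 1 g1 (ratr (- (1 / 48)) * ((0 - 1) / (1 - x)) * g1 x) ->
  is_derive x 1 g2 (ratr (- (1 / 6)) * ((8 * b)^-1 * (7 - 4 * b)
    / ((8 * b)^-1 * lam b x)) * g2 x) ->
  is_derive x 1 (fun z => g1 z * g2 z) (ldT b x * (g1 x * g2 x)).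
Proof.
move=> l0 x1 d1 d2; have := is_derive_mul d1 d2; congr is_derive.
rewrite /ldT !rmorphN !fmorph_div !rmorph1 !rmorph_nat -mulf_div divff ?mul1r.
  move: (lam b x) l0 (1 - x) x1 => l l0 X x1; move: (g1 x) (g2 x) => u v.
  by field; rewrite l0 x1.
by rewrite invr_eq0 mulf_neq0 ?pnatr_eq0.
Qed.

Lemma ler_frac (m n p q : nat) : (0 < n)%N -> (0 < q)%N -> (m * q <= p * n)%N ->
  m%:R / n%:R <= p%:R / q%:R :> K.
Proof.
move=> n0 q0 h; rewrite ler_pdivrMr ?ltr0n // mulrAC ler_pdivlMr ?ltr0n //.
by rewrite -!natrM ler_nat.
Qed.

End CoverPullback.

(** * The covering, the transformation of equations and the two identities *)

Section Main.
Variable R : realType.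
Local Notation C := (cplx R).
Variables (beta : C) (hbeta : beta ^+ 2 + 2 = 0).

Lemma sqr_beta : beta ^+ 2 = -2.
Proof. by apply/eqP; rewrite -addr_eq0 hbeta. Qed.
Let hb := sqr_beta.

Lemma rat_eval_phi4 : rat_eval (phi4 beta) = phix beta.
Proof.
apply/funext => x; rewrite -(phixE hb) /rat_eval -horner_exp.
by [].
Qed.

Lemma covering_phi4 : is_covering (phi4 beta) 10.
Proof.
have deg : rat_deg (phi4 beta) = 10%N.
  have sN : size (num (phi4 beta)) = 11%N := size_num4 hb.
  have sD : (size (den (phi4 beta)) <= 10)%N := size_den4 beta.
  by rewrite /rat_deg sN (maxn_idPl _) //; exact: leqW sD.
rewrite -deg; apply: is_covering_coprime; last by rewrite deg.
by apply: Pdiv.ClosedField.root_coprimep => x; exact: (num4_root_den hb).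
Qed.

(** The normalization at 0 and the logarithmic derivative are what the two identities use of the
    branch. *)
Lemma pow_at0_derive (f : C -> C) (r : rat) (f1 : C -> C) :
  -1 <= r -> r < 0 -> f 0 = 1 -> (forall z : C, is_derive (z : C) 1 f (f1 z)) ->
  pow_at0 f r 0 = 1 /\ \forall z \near (0 : C),
    is_derive (z : C) 1 (pow_at0 f r) (ratr r * (f1 z / f z) * pow_at0 f r z).
Proof.
move=> r1 r0 f0 df; have fc : \forall z \near (0 : C), {for z, continuous f}.
  by near=> z; exact (is_derive_continuous (df z)).
have [t0 [U oU br]] := pow_at0_branch r1 r0 f0 fc.
split=> //; near=> z.
have Uz : U z by near: z; exact: open_nbhs_nbhs.
exact (power_branch_derive oU.1 Uz br (df z)).2.
Unshelve. all: by end_near. Qed.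

(** The two operators differ by the factor t kappa, which settles one implication. The converse
    divides by it: t is a branch of a nonzero function, and kappa is nonzero because phi_4(x) != 0
    excludes w = 0. *)
Lemma phi4_pullback : defines_pullback (phi4 beta) [:: 1 / 2; 1 / 3; 1 / 8]
  [:: 1 / 3; 1 / 8; 1 / 8].
Proof.
exists (1 / 48), (17 / 48), (7 / 8), (5 / 24), (13 / 24), (7 / 8).
exists [:: (RatFun (cub4 beta) 1, - (1 / 16))]; split.
- exists (1 / 8), (1 / 2), (1 / 3); split.
  + apply/permPl; exact: (perm_catC [:: 1 / 8] [:: 1 / 2; 1 / 3]).
  + by left; field.
  + by left; field.
  + by right; field.
- exists (1 / 8), (1 / 8), (1 / 3); split.
  + apply/permPl; exact: (perm_catC [:: 1 / 8; 1 / 8] [:: 1 / 3]).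
  + by left; field.
  + by left; field.
  + by right; field.
- rewrite /= oner_neq0 !andbT; apply/eqP => c0.
  by have := cubQ_wcoord0_neq0 hb; rewrite -cub4_neq0 // c0 horner0 eqxx.
move=> U t y oU Ureg [g [t' [brg t'1 tE]]] dy.
rewrite !rat_eval_phi4 in dy *.
have k0 : - (729 / 2) != 0 :> C by rewrite oppr_eq0 mulf_neq0 ?invr_eq0 ?pnatr_eq0.
have fE : rat_eval (RatFun (cub4 beta) 1) = fun z => - (729 / 2) * cubQ (wcoord beta z).
  apply/funext => z; rewrite -(cub4E hb) -[RHS]divr1 /rat_eval.
  by congr (_ / _); exact: hornerC.
have QU x : U x -> cubQ (wcoord beta x) != 0.
  move=> /Ureg[_ _ d0 _ _]; rewrite -(cub4_neq0 hb).
  by apply: contra_neq d0 => c0; rewrite /= horner_exp c0 expr0n.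
have dt x : U x -> t x != 0 /\ is_derive (x : C) 1 t (ldQ beta x * t x).
  move=> Ux; rewrite fE in brg.
  have [gx0 dg] := power_branch_derive oU Ux brg (is_derive_scaled_cubQ beta _ x).
  have tg z : U z -> g z = t z by move=> Uz; rewrite tE // t'1 // mulr1.
  rewrite -tg //; split=> //.
  apply: (@near_eq_is_derive _ _ _ g); last by rewrite -(scaled_ldQ beta x k0).
  by near=> z; apply: tg; near: z; exact: open_nbhs_nbhs.
have op x : U x -> [/\ derivable (fun z => t z * y (phix beta z)) x 1,
    derivable (derive1 (fun z => t z * y (phix beta z))) x 1
    & hyp_op (5 / 24) (13 / 24) (7 / 8) (fun z => t z * y (phix beta z)) x =
      t x * kappa beta x * hyp_op (1 / 48) (17 / 48) (7 / 8) y (phix beta x)].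
  move=> Ux; have nU : \forall z \near x, U z by exact: open_nbhs_nbhs.
  have dtn : \forall z \near x, is_derive (z : C) 1 t (ldQ beta z * t z).
    exact (filterS (fun z Uz => (dt z Uz).2) nU).
  have dyn : \forall z \near x, derivable y (phix beta z) 1.
    exact (filterS (fun z Uz => (dy z Uz).1) nU).
  exact (cover_pullback hb (QU x Ux) dtn dyn (dy x Ux).2).
split=> h x Ux; have [dG ddG e] := op x Ux; have hx := (h x Ux).2.
- have y0 : hyp_op (1 / 48) (17 / 48) (7 / 8) y (phix beta x) = 0 := hx.
  rewrite y0 mulr0 in e; exact (conj (conj dG ddG) e).
- have G0 : hyp_op (5 / 24) (13 / 24) (7 / 8) (fun z => t z * y (phix beta z)) x = 0 := hx.
  suff y0 : hyp_op (1 / 48) (17 / 48) (7 / 8) y (phix beta x) = 0.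
    exact (conj (dy x Ux) y0).
  move: G0; rewrite e => /eqP; rewrite mulf_eq0 => /orP[|/eqP //].
  have [_ _ _ phi0 _] := Ureg x Ux; move: phi0; rewrite rat_eval_phi4 => phi0.
  have w0 : wcoord beta x != 0.
    by apply: contra_neq phi0; rewrite /phix /phiw => ->; rewrite expr0n !mul0r.
  have [t0 _] := dt x Ux.
  by rewrite (negbTE (mulf_neq0 t0 (kappa_neq0 w0 (QU x Ux)))).
Unshelve. all: by end_near. Qed.

Lemma phi4_identity_at0 : \forall x \near (0 : C),
  hyp2F1 (5 / 24) (13 / 24) (7 / 8) x =
  pow_at0 (fun x : C =>
      1 + 16 * (4 - 17 * beta) / 9 * x
        - 64 * (167 - 136 * beta) / 243 * x ^+ 2
        + 2048 * (112 - 17 * beta) / 6561 * x ^+ 3) (- (1 / 16)) x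
  * hyp2F1 (1 / 48) (17 / 48) (7 / 8) (rat_eval (phi4 beta) x).
Proof.
rewrite rat_eval_phi4.
have -> : (fun x : C =>
      1 + 16 * (4 - 17 * beta) / 9 * x
        - 64 * (167 - 136 * beta) / 243 * x ^+ 2
        + 2048 * (112 - 17 * beta) / 6561 * x ^+ 3) =
    fun x => (cubQ (wcoord beta 0))^-1 * cubQ (wcoord beta x).
  by apply/funext => x; exact: normalized_cubic.
have k0 := cubQ_wcoord0_neq0 hb.
have [] := pow_at0_derive (r := - (1 / 16)) isT isT (mulVf k0)
  (is_derive_scaled_cubQ beta _).
set t := pow_at0 _ _ => t0 dt.
have frac (m n p q : nat) := @ler_frac C m n p q.
have c0 : 0 < 7 / 8 :> C by rewrite divr_gt0.
apply: (near_hyp_solution_unique c0).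
- apply: hyp2F1_solution => //; rewrite ?divr_ge0 //; first exact: (frac 5 24 7 8).
  by rewrite ler_pdivrMr // mul1r ler_nat.
- apply: (near_cover_solution hb).
    by apply: filterS dt => z; rewrite scaled_ldQ // invr_neq0.
  apply: hyp2F1_solution => //; rewrite ?divr_ge0 //; first exact: (frac 1 48 7 8).
  by rewrite ler_pdivrMr // mul1r ler_nat.
- exact: hyp2F1_0.
- by rewrite t0 mul1r (phix0 hb) hyp2F1_0.
Qed.

Lemma phi4_identity_at_infinity : \forall x \near (0 : C),
  hyp2F1 (5 / 24) (1 / 3) (2 / 3) x =
  pow_at0 (fun x : C => 1 - x) (- (1 / 48)) x
  * pow_at0 (fun x : C => 1 - (8 + 7 * beta) / 16 * x) (- (1 / 6)) x
  * hyp2F1 (1 / 48) (7 / 48) (2 / 3) (1 / rat_eval (phi4 beta) (1 / x)).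
Proof.
rewrite rat_eval_phi4.
have -> : (fun x : C => 1 - (8 + 7 * beta) / 16 * x) =
    fun x => (8 * beta)^-1 * lam beta x.
  by apply/funext => x; exact: normalized_lam.
have d1 (z : C) : is_derive (z : C) 1 (fun x : C => 1 - x) (0 - 1).
  exact (is_derive_sub (is_derive_const 1 z) (is_derive_var z)).
have d2 (z : C) : is_derive (z : C) 1 (fun x : C => (8 * beta)^-1 * lam beta x)
    ((8 * beta)^-1 * (7 - 4 * beta)).
  have := is_derive_mul (is_derive_const (8 * beta)^-1 z) (is_derive_lam beta z).
  by congr is_derive; rewrite mul0r add0r.
have [] := pow_at0_derive (r := - (1 / 48)) isT isT (subr0 _) d1.
set g1 := pow_at0 _ _ => g10 dg1.
have l01 : (8 * beta)^-1 * lam beta 0 = 1.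
  by rewrite /lam mulr0 addr0 mulVf // mulf_neq0 ?pnatr_eq0 // b_neq0.
have [] := pow_at0_derive (r := - (1 / 6)) isT isT l01 d2.
set g2 := pow_at0 _ _ => g20 dg2.
have frac (m n p q : nat) := @ler_frac C m n p q.
have c0 : 0 < 2 / 3 :> C by rewrite divr_gt0.
have sol : near_hyp_solution (5 / 24) (1 / 3) (2 / 3)
    (fun z => g1 z * g2 z * hyp2F1 (1 / 48) (7 / 48) (2 / 3) (psix beta z)).
  apply: (near_cover_inf_solution hb).
    have nl := near_lam_neq0 hb; have n1 := @near_one_sub_neq0 C.
    near=> z; have lz : lam beta z != 0 by near: z.
    have z1 : 1 - z != 0 by near: z.
    have dg1z : is_derive (z : C) 1 g1 (ratr (- (1 / 48)) * ((0 - 1) / (1 - z)) * g1 z).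
      by near: z.
    have dg2z : is_derive (z : C) 1 g2 (ratr (- (1 / 6)) * ((8 * beta)^-1 * (7 - 4 * beta)
        / ((8 * beta)^-1 * lam beta z)) * g2 z) by near: z.
    exact (is_derive_theta_inf hb lz z1 dg1z dg2z).
  apply: hyp2F1_solution => //; rewrite ?divr_ge0 //; first exact: (frac 1 48 2 3).
  by rewrite ler_pdivrMr // mul1r ler_nat.
have solF : near_hyp_solution (5 / 24) (1 / 3) (2 / 3) (hyp2F1 (5 / 24) (1 / 3) (2 / 3) : C -> C).
  apply: hyp2F1_solution => //; rewrite ?divr_ge0 //; first exact: (frac 5 24 2 3).
  by rewrite ler_pdivrMr // mul1r ler1n.
have sol0 : g1 0 * g2 0 * hyp2F1 (1 / 48) (7 / 48) (2 / 3) (psix beta 0) = 1.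
  by rewrite g10 g20 psix0 hyp2F1_0 !mulr1.
have eqFG := near_hyp_solution_unique c0 solF sol (hyp2F1_0 _ _ _) sol0.
have npsi := near_psix hb.
near=> x; have psiE : 1 / phix beta (1 / x) = psix beta x by near: x.
by rewrite psiE; near: x.
Unshelve. all: by end_near. Qed.

End Main.

(* In the last identity, the value of 1 / phi4 (1 / x) at x = 0 (that is,
   phi4 oo = oo) is 0, which is also what the convention 0^-1 = 0 gives, as
   phi4 0 = 0. *)
Theorem mainTheorem5 (R : realType) (beta : cplx R) (hbeta : beta ^+ 2 + 2 = 0) :
  [/\ is_covering (phi4 beta) 10,
      defines_pullback (phi4 beta) [:: 1 / 2; 1 / 3; 1 / 8]
        [:: 1 / 3; 1 / 8; 1 / 8],
      \forall x \near (0 : cplx R),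
        hyp2F1 (5 / 24) (13 / 24) (7 / 8) x =
        pow_at0 (fun x : cplx R =>
            1 + 16 * (4 - 17 * beta) / 9 * x
              - 64 * (167 - 136 * beta) / 243 * x ^+ 2
              + 2048 * (112 - 17 * beta) / 6561 * x ^+ 3) (- (1 / 16)) x
        * hyp2F1 (1 / 48) (17 / 48) (7 / 8) (rat_eval (phi4 beta) x)
    & \forall x \near (0 : cplx R),
        hyp2F1 (5 / 24) (1 / 3) (2 / 3) x =
        pow_at0 (fun x : cplx R => 1 - x) (- (1 / 48)) x
        * pow_at0 (fun x : cplx R => 1 - (8 + 7 * beta) / 16 * x) (- (1 / 6)) x
        * hyp2F1 (1 / 48) (7 / 48) (2 / 3)
            (1 / rat_eval (phi4 beta) (1 / x))].
Proof.
split.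
- exact: covering_phi4.
- exact: phi4_pullback.
- exact: phi4_identity_at0.
- exact: phi4_identity_at_infinity.
Qed.
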